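(* Let $h:\mathbb{N}\to(0,\infty)$ be a growth function and $(H_0,H_1)=(\ell^2,\ell^2_h)$. (a) If $\mathfrak{a},\mathfrak{b}\in\mathfrak{G}_1$ are shift-invariant growth types and $\mathcal{F}_h^{\mathfrak{a}\mathfrak{b}}\neq\emptyset$, then the growth type $[h]$ is shift-invariant. If the growth type $[h]$ is shift-invariant, then the following are true: (b) If a growth type $\mathfrak{a}\in\mathfrak{G}$ satisfies $(\mathcal{F}_h^{\mathfrak{a}\mathfrak{a}})^*\neq\emptyset$, then $\mathfrak{a}$ is shift-invariant. (c) There are infinitely many pairs $(\mathfrak{a},\mathfrak{b})\in\mathfrak{G}_1\times\mathfrak{G}_1$ of shift-invariant growth types with $\mathcal{F}_h^{\mathfrak{a}\mathfrak{b}}\neq\emptyset$.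
   Context: $\mathbb{N}=\{1,2,\dots\}$. A growth function is a monotone (nondecreasing) unbounded function $f:\mathbb{N}\to(0,\infty)$. Two growth functions $f,g$ have the same growth type, $f\sim g$, if there is $c>0$ with $\frac1c g(\nu)\le f(\nu)\le c\,g(\nu)$ for all $\nu$. The equivalence classes $[f]$ are called growth types; $\mathfrak{G}$ is the set of growth types. The shift of $f$ is $f_1(\nu):=f(\nu+1)$; a growth type $[f]$ is shift-invariant if $f\sim f_1$; $\mathfrak{G}_1\subset\mathfrak{G}$ is the set of shift-invariant growth types. For a growth function $f$ and $r\in\mathbb{R}$, $\ell^2_{f^r}$ is the Hilbert space of real sequences $x=(x_\nu)_{\nu\in\mathbb{N}}$ with $\sum_\nu f(\nu)^r x_\nu^2<\infty$, with inner product $\langle x,y\rangle=\sum_\nu f(\nu)^r x_\nu y_\nu$. Given $h$, put $H_r:=\ell^2_{h^r}$; for $s<r$ the inclusion $H_r\subset H_s$ is compact and dense. Let $\iota$ denote the inclusion $H_1\hookrightarrow H_0$. The space of weak Hessians $\mathcal{H}_h\subset\mathcal{L}(H_1,H_0)\cap\mathcal{L}(H_2,H_1)$ consists of all bounded linear maps $A:H_1\to H_0$ which are Fredholm of index zero, $H_0$-symmetric ($\langle Ax,y\rangle_0=\langle x,Ay\rangle_0$ for all $x,y\in H_1$), and which restrict to a bounded linear map $H_2\to H_1$ that is also Fredholm of index zero. The spectrum $\operatorname{spec}A$ (the set of real $\lambda$ for which $A-\lambda\iota$ is not an isomorphism) of $A\in\mathcal{H}_h$ consists of discrete real eigenvalues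 of finite multiplicity, and there is an orthonormal basis of $H_0$ of eigenvectors of $A$ in $H_1$. $\mathcal{F}_h\subset\mathcal{H}_h$ denotes the subset of Floer type weak Hessians, i.e. those with infinitely many positive and infinitely many negative eigenvalues, and $\mathcal{F}_h^*\subset\mathcal{F}_h$ the subset of invertible ones. For $A\in\mathcal{F}_h^*$, the positive growth function $f_A^+:\mathbb{N}\to(0,\infty)$ lists the positive eigenvalues of $A$ with multiplicities in increasing order; the negative growth function $f_A^-$ lists in the same way the absolute values of the negative eigenvalues. For $\mathfrak{a},\mathfrak{b}\in\mathfrak{G}$, $$(\mathcal{F}_h^{\mathfrak{a}\mathfrak{b}})^*:=\{A\in\mathcal{F}_h^*\mid [f_A^-]=\mathfrak{a},\ [f_A^+]=\mathfrak{b}\}.$$ For $\lambda\in\mathbb{R}$ write $\mathbb{A}_\lambda:=A-\lambda\iota\in\mathcal{F}_h$. For $\mathfrak{a},\mathfrak{b}\in\mathfrak{G}_1$, $$\mathcal{F}_h^{\mathfrak{a}\mathfrak{b}}:=\{A\in\mathcal{F}_h\mid \forall\lambda\in\mathbb{R}\setminus\operatorname{spec}A:\ [f^-_{\mathbb{A}_\lambda}]=\mathfrak{a}\ \text{and}\ [f^+_{\mathbb{A}_\lambda}]=\mathfrak{b}\}.$$ *)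

(* Defs.v *)
From HB Require Import structures.
From mathcomp Require Import all_boot all_order all_algebra.
From mathcomp Require Import all_classical all_reals all_analysis.
From mathcomp Require Import generic_quotient ring lra.

(* MathComp-Analysis; the reals are an arbitrary R : realType.                *)
(* Sequences are indexed by nat, so the index nu = 1, 2, ... of a growth      *)
(* function or of an element of l^2 is represented by n = nu - 1.             *)

Set Implicit Arguments.
Unset Strict Implicit.
Unset Printing Implicit Defensive.

Import Order.TTheory GRing.Theory Num.Theory.
Import numFieldNormedType.Exports.

Local Open Scope classical_set_scope.
Local Open Scope card_scope.
Local Open Scope quotient_scope.
Local Open Scope ring_scope.

Record growth_fun (R : realType) := GrowthFun {
  growth_val :> nat -> R;
  growth_gt0 : forall n, 0 < growth_val n;
  growth_nd : nondecreasing_seq growth_val;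
  growth_unbounded : forall M : R, exists n, M < growth_val n }.

HB.instance Definition _ (R : realType) := gen_eqMixin (growth_fun R).
HB.instance Definition _ (R : realType) := gen_choiceMixin (growth_fun R).

Section GrowthTypes.
Variable R : realType.
Implicit Types f g : growth_fun R.

Lemma growth_ge0 f n : 0 <= f n.
Proof. exact: ltW (growth_gt0 f n). Qed.

Definition same_growth (f g : nat -> R) : Prop :=
  exists2 c : R, 0 < c & forall n, c^-1 * g n <= f n <= c * g n.

Definition same_growthb : rel (growth_fun R) := fun f g => `[< same_growth f g >].

Lemma same_growth_refl f : same_growth f f.
Proof. by exists 1 => // n; rewrite invr1 !mul1r lexx. Qed.

Lemma same_growth_sym (f g : nat -> R) : same_growth f g -> same_growth g f.
Proof.
move=> [c c0 fg]; exists c => // n; have /andP[gf fg'] := fg n.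
by rewrite mulrC ler_pdivrMr// mulrC fg' /= -ler_pdivrMl.
Qed.

Lemma same_growth_trans (f g k : nat -> R) :
  same_growth f g -> same_growth g k -> same_growth f k.
Proof.
move=> [c c0 fg] [d d0 gk]; exists (c * d); first exact: mulr_gt0.
move=> n; have /andP[gf fg'] := fg n; have /andP[kg gk'] := gk n.
apply/andP; split.
  rewrite invfM -mulrA; apply: le_trans gf.
  by rewrite ler_pM2l ?invr_gt0.
by rewrite -mulrA; apply: le_trans fg' _; rewrite ler_pM2l.
Qed.

Lemma same_growthb_refl : reflexive same_growthb.
Proof. by move=> f; apply/asboolP; exact: same_growth_refl. Qed.

Lemma same_growthb_sym : symmetric same_growthb.
Proof. by move=> f g; apply/asboolP/asboolP; exact: same_growth_sym. Qed.

Lemma same_growthb_trans : transitive same_growthb.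
Proof.
move=> g f k /asboolP fg /asboolP gk.
by apply/asboolP; exact: same_growth_trans fg gk.
Qed.

Canonical same_growth_equiv := EquivRel same_growthb
  same_growthb_refl same_growthb_sym same_growthb_trans.

Definition growth_type := {eq_quot same_growth_equiv}.

Definition type_of_growth (f : growth_fun R) : growth_type := \pi_growth_type f.

Definition shift (f : nat -> R) : nat -> R := fun n => f n.+1.

Definition shift_invariant (a : growth_type) : Prop :=
  exists2 f : growth_fun R, type_of_growth f = a & same_growth f (shift f).

Lemma type_of_growthP f g :
  type_of_growth f = type_of_growth g <-> same_growth f g.
Proof.
rewrite /type_of_growth; split=> [/eqmodP/asboolP//|fg].
by apply/eqmodP/asboolP.
Qed.

Lemma shift_invariantE f :
  shift_invariant (type_of_growth f) <-> same_growth f (shift f).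
Proof.
split=> [[g /type_of_growthP gf gS]|fS]; last by exists f.
apply: (same_growth_trans (same_growth_sym gf)).
apply: (same_growth_trans gS).
by have [c c0 cP] := gf; exists c => // n; exact: cP.
Qed.

End GrowthTypes.

Section WeightedL2.
Variables (R : realType) (f : growth_fun R) (r : R).

Definition weighted_prod (x y : nat -> R) : nat -> R :=
  fun n => f n `^ r * x n * y n.

Definition l2_pred : {pred nat -> R} :=
  mem [set x : nat -> R | cvgn (series (weighted_prod x x))].

Record l2 := L2 { l2_val :> nat -> R; _ : l2_val \in l2_pred }.

HB.instance Definition _ := [isSub for l2_val].
HB.instance Definition _ := [Choice of l2 by <:].

Lemma weight_gt0 n : 0 < f n `^ r.
Proof. by rewrite powR_gt0// growth_gt0. Qed.

Lemma weighted_sq_ge0 (x : nat -> R) n : 0 <= weighted_prod x x n.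
Proof.
by rewrite /weighted_prod -mulrA mulr_ge0 ?(ltW (weight_gt0 n))// -expr2 sqr_ge0.
Qed.

Lemma l2_prod_cvg (x y : nat -> R) : x \in l2_pred -> y \in l2_pred ->
  cvgn (series (weighted_prod x y)).
Proof.
rewrite !inE /= => cx cy; apply: normed_cvg.
apply: (@series_le_cvg _ _ (weighted_prod x x + weighted_prod y y)).
- by move=> n /=.
- by move=> n; rewrite addr_ge0 ?weighted_sq_ge0.
- move=> n /=; rewrite -[leRHS]/(weighted_prod x x n + weighted_prod y y n).
  rewrite /weighted_prod -!mulrA normrM (gtr0_norm (weight_gt0 n)) -mulrDr.
  rewrite ler_pM2l ?weight_gt0// normrM -!expr2.
  rewrite -(real_normK (num_real (x n))) -(real_normK (num_real (y n))).
  set a := `|x n|; set b := `|y n|.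
  have ab : 0 <= a * b by rewrite mulr_ge0 /a /b.
  have := sqr_ge0 (a - b); rewrite sqrrB -mulr_natr; lra.
- by rewrite seriesD; exact: is_cvgD.
Qed.

Lemma weighted_prodDl (a : R) (x y z : nat -> R) :
  weighted_prod (a *: x + y) z = a *: weighted_prod x z + weighted_prod y z.
Proof.
apply/funext => n.
rewrite /weighted_prod -[(_ + _) n]/(a * x n + y n).
rewrite -[RHS]/(a * (f n `^ r * x n * z n) + f n `^ r * y n * z n); ring.
Qed.

Lemma weighted_prodC (x y : nat -> R) : weighted_prod x y = weighted_prod y x.
Proof. by apply/funext => n; rewrite /weighted_prod mulrAC. Qed.

Lemma l2_submod_closed : submod_closed l2_pred.
Proof.
split.
  rewrite inE /= (_ : weighted_prod 0 0 = cst 0); last first.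
    by apply/funext => n; rewrite /weighted_prod mulr0.
  rewrite (_ : series (cst 0) = cst 0); first exact: is_cvg_cst.
  by apply/funext => n; rewrite /series /= big1.
move=> a x y xl yl.
have xy := l2_prod_cvg xl yl; have yx := l2_prod_cvg yl xl.
move: xl yl; rewrite !inE /= => xl yl.
rewrite weighted_prodDl (weighted_prodC x) (weighted_prodC y) !weighted_prodDl.
rewrite seriesD seriesZ !seriesD !seriesZ.
by do !(apply: is_cvgD || apply: is_cvgZl_tmp).
Qed.

HB.instance Definition _ :=
  GRing.isSubmodClosed.Build R (nat -> R) l2_pred l2_submod_closed.
HB.instance Definition _ := [SubChoice_isSubLmodule of l2 by <:].

Definition l2_inner (x y : l2) : R := limn (series (weighted_prod x y)).

Definition l2_norm (x : l2) : R := Num.sqrt (l2_inner x x).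

Lemma l2_innerP (a : R) (x y z : l2) :
  l2_inner (a *: x + y) z = a * l2_inner x z + l2_inner y z.
Proof.
rewrite /l2_inner.
have xz := l2_prod_cvg (valP x) (valP z); have yz := l2_prod_cvg (valP y) (valP z).
rewrite (_ : l2_val (a *: x + y) = a *: (x : nat -> R) + (y : nat -> R)) //.
rewrite weighted_prodDl seriesD seriesZ.
apply/cvg_lim => //; apply: cvgD; last exact: yz.
by apply: cvgZl_tmp; exact: xz.
Qed.

Lemma l2_innerC (x y : l2) : l2_inner x y = l2_inner y x.
Proof. by rewrite /l2_inner weighted_prodC. Qed.

Lemma l2_inner_ge (x : l2) n : weighted_prod x x n <= l2_inner x x.
Proof.
apply: (@le_trans _ _ (series (weighted_prod x x) n.+1)).
  rewrite /series /= big_nat_recr//= lerDr sumr_ge0// => i _.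
  exact: weighted_sq_ge0.
apply: nondecreasing_cvgn_le; last exact: l2_prod_cvg (valP x) (valP x).
by apply: nondecreasing_series => i _ _; exact: weighted_sq_ge0.
Qed.

Lemma l2_inner_ge0 (x : l2) : 0 <= l2_inner x x.
Proof. exact: le_trans (weighted_sq_ge0 _ 0) (l2_inner_ge x 0). Qed.

Lemma l2_inner_eq0 (x : l2) : l2_inner x x = 0 -> x = 0.
Proof.
move=> x0; apply/val_inj/funext => n /=.
have := l2_inner_ge x n; rewrite x0 => xn.
have /eqP : weighted_prod x x n = 0.
  by apply/eqP; rewrite eq_le xn weighted_sq_ge0.
by rewrite /weighted_prod !mulf_eq0 (gt_eqF (weight_gt0 n)) /= orbb => /eqP.
Qed.

Lemma l2_inner_expand (a b : R) (x y : l2) :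
  l2_inner (a *: x + b *: y) (a *: x + b *: y) =
  a ^+ 2 * l2_inner x x + 2 * a * b * l2_inner x y + b ^+ 2 * l2_inner y y.
Proof.
have E u v w : l2_inner u (v + w) = l2_inner u v + l2_inner u w.
  by rewrite -[v]scale1r l2_innerC l2_innerP mul1r !(l2_innerC u) scale1r.
have Z u v c : l2_inner u (c *: v) = c * l2_inner u v.
  rewrite -[c *: v]addr0 l2_innerC l2_innerP (l2_innerC u).
  have -> : l2_inner 0 u = 0; last by rewrite addr0.
  by have := l2_innerP 1 0 0 u; rewrite scaler0 addr0 mul1r; lra.
have Z' u v c : l2_inner (c *: u) v = c * l2_inner u v.
  by rewrite l2_innerC Z l2_innerC.
rewrite l2_innerP Z' !E !Z (l2_innerC y x); ring.
Qed.

Lemma l2_cauchy_schwarz (x y : l2) :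
  l2_inner x y ^+ 2 <= l2_inner x x * l2_inner y y.
Proof.
have [y0|y0] := eqVneq (l2_inner y y) 0.
  have := l2_innerP 1 0 0 x; rewrite scaler0 addr0 mul1r => z.
  rewrite y0 mulr0 (l2_inner_eq0 y0) l2_innerC.
  by rewrite (_ : l2_inner 0 x = 0) ?expr0n//; lra.
have yp : 0 < l2_inner y y by rewrite lt0r y0 l2_inner_ge0.
have := l2_inner_ge0 (l2_inner y y *: x + (- l2_inner x y) *: y).
rewrite l2_inner_expand; set q := l2_inner y y; set p := l2_inner x y.
rewrite (_ : _ + _ = q * (q * l2_inner x x - p ^+ 2)); last ring.
by rewrite pmulr_rge0// subr_ge0 [_ * q]mulrC.
Qed.

Lemma l2_norm_triangle (x y : l2) : l2_norm (x + y) <= l2_norm x + l2_norm y.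
Proof.
rewrite -(ler_pXn2r (ltn0Sn 1)) ?nnegrE ?addr_ge0 ?sqrtr_ge0//.
rewrite sqrrD !sqr_sqrtr ?l2_inner_ge0//.
rewrite -[x in l2_inner (x + _) _]scale1r -[y in l2_inner (_ + y) _]scale1r.
rewrite -[x in l2_inner _ (x + _)]scale1r -[y in l2_inner _ (_ + y)]scale1r.
rewrite l2_inner_expand expr1n !mul1r !mulr1 lerD2r lerD2l.
rewrite -[leRHS]mulr_natl ler_pM2l// /l2_norm -sqrtrM ?l2_inner_ge0//.
apply: le_trans (ler_norm _) _.
by rewrite -sqrtr_sqr ler_wsqrtr// l2_cauchy_schwarz.
Qed.

Lemma l2_normZ (a : R) (x : l2) : l2_norm (a *: x) = `|a| * l2_norm x.
Proof.
rewrite /l2_norm -[a *: x]addr0 -[X in _ + X](scale0r x).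
rewrite l2_inner_expand (_ : _ + _ = a ^+ 2 * l2_inner x x); last ring.
by rewrite sqrtrM ?sqr_ge0// sqrtr_sqr.
Qed.

Lemma l2_norm_eq0 (x : l2) : l2_norm x = 0 -> x = 0.
Proof.
move=> x0; apply: l2_inner_eq0.
by rewrite -[LHS]sqr_sqrtr ?l2_inner_ge0// -/(l2_norm x) x0 expr0n.
Qed.

HB.instance Definition _ :=
  Lmodule_isNormed.Build R l2 l2_norm_triangle l2_normZ l2_norm_eq0.

Lemma l2_normE (x : l2) : `|x| = Num.sqrt (l2_inner x x).
Proof. by []. Qed.

End WeightedL2.

Section Inclusion.
Variables (R : realType) (f : growth_fun R) (s r : R).
Hypothesis sr : s <= r.

Lemma l2_predS (x : nat -> R) : x \in l2_pred f r -> x \in l2_pred f s.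
Proof.
rewrite !inE /= => xr; set c := f 0%N `^ (s - r).
apply: (@series_le_cvg _ _ (c *: weighted_prod f r x x)).
- exact: weighted_sq_ge0.
- move=> n; rewrite -[c *: _]/(fun n => c * _) mulr_ge0 ?powR_ge0//.
  exact: weighted_sq_ge0.
- move=> n; rewrite -[(c *: _) n]/(c * _) /weighted_prod -!mulrA.
  rewrite [leRHS]mulrA ler_wpM2r -?expr2 ?sqr_ge0//.
  rewrite -[in leLHS](subrK r s) powRD; last by rewrite (gt_eqF (growth_gt0 f n)) implybT.
  rewrite ler_wpM2r ?powR_ge0// /c -(opprB r s) !powRN.
  rewrite lef_pV2 ?posrE ?powR_gt0 ?growth_gt0//.
  by rewrite ge0_ler_powR ?subr_ge0 ?nnegrE ?growth_ge0 ?growth_nd.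
- by rewrite seriesZ; exact: is_cvgZl_tmp.
Qed.

Definition l2_incl (x : l2 f r) : l2 f s := L2 (l2_predS (valP x)).

Lemma l2_incl_linear : linear l2_incl.
Proof. by move=> a x y; exact: val_inj. Qed.

HB.instance Definition _ :=
  GRing.isLinear.Build R (l2 f r) (l2 f s) _ l2_incl l2_incl_linear.

End Inclusion.

Section Operators.
Variable R : realType.

Definition bounded_op (V W : normedModType R) (T : V -> W) : Prop :=
  exists C : R, forall x, `|T x| <= C * `|x|.

Definition isomorphism (V W : normedModType R) (T : {linear V -> W}) : Prop :=
  bounded_op T /\
  exists S : {linear W -> V}, [/\ bounded_op S, cancel T S & cancel S T].

Definition has_dim (V : lmodType R) (K : set V) (n : nat) : Prop :=
  exists e : 'I_n -> V,
    (forall c : 'I_n -> R, \sum_i c i *: e i = 0 -> forall i, c i = 0) /\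
    K = [set \sum_i c i *: e i | c in [set: 'I_n -> R]].

(* The classes of the e i form a basis of the quotient W / I. *)
Definition has_codim (W : lmodType R) (I : set W) (n : nat) : Prop :=
  exists e : 'I_n -> W,
    (forall c : 'I_n -> R, I (\sum_i c i *: e i) -> forall i, c i = 0) /\
    (forall w, exists c : 'I_n -> R, I (w - \sum_i c i *: e i)).

Definition fredholm_of_index (V W : normedModType R) (T : {linear V -> W})
    (k : int) : Prop :=
  [/\ bounded_op T, closed (range T) &
      exists m n : nat, [/\ has_dim [set x | T x = 0] m,
        has_codim (range T) n & k = m%:Z - n%:Z]].

End Operators.

Section WeakHessians.
Variables (R : realType) (h : growth_fun R).

Local Notation H r := (l2 h r).
Local Notation "<| x , y |>_ r" := (@l2_inner R h r x y)
  (at level 0, x, y at level 99, r at level 0).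

Definition incl10 : {linear H 1 -> H 0} := @l2_incl R h 0 1 ler01.

Definition incl21 : {linear H 2 -> H 1} := @l2_incl R h 1 2 (ler1n R 2).

Definition weak_hessian : set {linear H 1 -> H 0} :=
  [set A | [/\ fredholm_of_index A 0,
    (forall x y : H 1, <| A x, incl10 y |>_0 = <| incl10 x, A y |>_0) &
    exists A2 : {linear H 2 -> H 1},
      (forall x, incl10 (A2 x) = A (incl21 x)) /\ fredholm_of_index A2 0]].

Definition shift_op (A : {linear H 1 -> H 0}) (lambda : R) :
    {linear H 1 -> H 0} :=
  A \- (lambda \*: incl10).

Definition spec (A : {linear H 1 -> H 0}) : set R :=
  [set lambda | ~ isomorphism (shift_op A lambda)].

Definition eigenspace (A : {linear H 1 -> H 0}) (mu : R) : set (H 1) :=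
  [set x | A x = mu *: incl10 x].

Definition is_eigenvalue (A : {linear H 1 -> H 0}) (mu : R) : Prop :=
  exists2 x, eigenspace A mu x & x != 0.

Definition floer : set {linear H 1 -> H 0} :=
  [set A | [/\ weak_hessian A,
    infinite_set [set mu | 0 < mu /\ is_eigenvalue A mu] &
    infinite_set [set mu | mu < 0 /\ is_eigenvalue A mu]]].

Definition floer_inv : set {linear H 1 -> H 0} :=
  [set A | floer A /\ isomorphism A].

(* A nondecreasing f with these fibres is the enumeration, in increasing      *)
(* order and with multiplicities, of the mu > 0 with E mu != 0; it is unique. *)
Definition lists_with_mult (E : R -> set (H 1)) (f : growth_fun R) : Prop :=
  forall mu : R, 0 < mu ->
    exists m : nat, has_dim (E mu) m /\ [set n | f n = mu] #= `I_m.

Definition is_pos_growth (A : {linear H 1 -> H 0}) (f : growth_fun R) : Prop :=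
  lists_with_mult (eigenspace A) f.

Definition is_neg_growth (A : {linear H 1 -> H 0}) (f : growth_fun R) : Prop :=
  lists_with_mult (fun mu => eigenspace A (- mu)) f.

Definition has_growth_types (A : {linear H 1 -> H 0}) (a b : growth_type R) :
    Prop :=
  (exists2 f, is_neg_growth A f & type_of_growth f = a) /\
  (exists2 f, is_pos_growth A f & type_of_growth f = b).

Definition floer_inv_of_type (a b : growth_type R) : set {linear H 1 -> H 0} :=
  [set A | floer_inv A /\ has_growth_types A a b].

(* Only used for shift-invariant a and b. *)
Definition floer_of_type (a b : growth_type R) : set {linear H 1 -> H 0} :=
  [set A | floer A /\
    forall lambda, ~ spec A lambda -> has_growth_types (shift_op A lambda) a b].

End WeakHessians.

Arguments weak_hessian {R} h.
Arguments floer {R} h.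
Arguments floer_inv {R} h.
Arguments floer_inv_of_type {R} h a b.
Arguments floer_of_type {R} h a b.

(* Main.v *)
Require Import Defs.
From HB Require Import structures.
From mathcomp Require Import all_boot all_order all_algebra.
From mathcomp Require Import all_classical all_reals all_analysis.
From mathcomp Require Import ring lra zify.

(* If A is symmetric and invertible then |A x|_0 is comparable to |x|_1, so   *)
(* by min-max the n-th eigenvalue of A^2 is comparable to h(n): the merged    *)
(* nondecreasing list g of f_A^- and f_A^+ satisfies g^2 ~ h.                 *)
(* (a) Merging two shift-invariant growth functions yields a shift-invariant  *)
(* one, and A - l is invertible for some l because A is Fredholm of index 0.  *)
(* (b) If f_A^- ~ f_A^+ =: f then f(n)^2 is comparable to h(2 n).             *)
(* (c) Let h(n+1) <= K h(n) and D > K^2, and let A be diagonal with entries   *)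
(* +sqrt(h) at the first indices p_k where h reaches h(0) D^k, and -sqrt(h)   *)
(* elsewhere.  Then f_A^+(k) is comparable to D^(k/2), the complement of the  *)
(* p_k has gaps at most 2, and distinct D give distinct growth types.         *)

Set Implicit Arguments.
Unset Strict Implicit.
Unset Printing Implicit Defensive.

Import Order.TTheory GRing.Theory Num.Theory.
Import numFieldNormedType.Exports.

Local Open Scope classical_set_scope.
Local Open Scope card_scope.
Local Open Scope ring_scope.

(** * Weighted l^2 spaces *)

(** Everything rests on comparing the spectrum of a symmetric isomorphism [A] from H 1 to H 0 with
    the weight [h]. There are c, C > 0 with c |x|_1^2 <= |A x|_0^2 <= C |x|_1^2. Moreover |x|_1^2 is
    at least h(n) |x|_0^2 when the first n coordinates of x vanish, and at most h(n) |x|_0^2 on the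
    span of the first n + 1 Dirac vectors. Two dimension counts follow. More than n orthonormal
    eigenvectors have a nonzero combination in the first space, so one of their squared eigenvalues
    is at least c h(n) ([eigen_weight_le]). At most n eigenvectors leave a nonzero vector orthogonal
    to them in the second space, and maximising the norm of the inverse of [A] on their orthogonal
    complement gives a further eigenvector, with squared eigenvalue at most C h(n)
    ([eigenvector_orthogonal]). [weyl_bounds] states both results for the negative and positive
    lists f and g. The merged list is never built: only numbers p and q of terms below a threshold
    occur.

    For (a), [fredholm_not_spec] supplies a regular value, and [weyl_weight_shift] passes from n to
    n + 1 at the price of one more term of f or of g, which shift invariance bounds by a constant
    factor. For (b), [weyl_eigen_shift] uses that when f and g are equivalent, half of the merged
    terms come from each list, so f(n+1) and f(n) are controlled by consecutive values of h near 2
    n. For (c), [sparse_signs] splits the indices into a sparse set, on which h is nearly geometric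
    of ratio D, and its complement; [diag_floer] turns the split into a diagonal operator with
    signs, and [geometric_types_differ] separates the types obtained from different D. *)

Section InnerProduct.
Variables (R : realType) (f : growth_fun R) (r : R).
Implicit Types x y z : l2 f r.

Local Notation "<| x , y |>" := (@l2_inner R f r x y)
  (at level 0, x, y at level 99).

Lemma l2_innerDl x y z : <| x + y, z |> = <| x, z |> + <| y, z |>.
Proof. by rewrite -[x]scale1r l2_innerP mul1r scale1r. Qed.

Lemma l2_inner0l z : <| 0, z |> = 0.
Proof. by apply: (@addrI _ <| 0, z |>); rewrite -l2_innerDl !addr0. Qed.

Lemma l2_innerZl a x z : <| a *: x, z |> = a * <| x, z |>.
Proof. by rewrite -[a *: x]addr0 l2_innerP l2_inner0l addr0. Qed.

Lemma l2_innerNl x z : <| - x, z |> = - <| x, z |>.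
Proof. by rewrite -scaleN1r l2_innerZl mulN1r. Qed.

Lemma l2_innerBl x y z : <| x - y, z |> = <| x, z |> - <| y, z |>.
Proof. by rewrite l2_innerDl l2_innerNl. Qed.

Lemma l2_innerDr x y z : <| z, x + y |> = <| z, x |> + <| z, y |>.
Proof. by rewrite l2_innerC l2_innerDl !(l2_innerC _ z). Qed.

Lemma l2_inner0r z : <| z, 0 |> = 0.
Proof. by rewrite l2_innerC l2_inner0l. Qed.

Lemma l2_innerZr a x z : <| z, a *: x |> = a * <| z, x |>.
Proof. by rewrite l2_innerC l2_innerZl l2_innerC. Qed.

Lemma l2_innerBr x y z : <| z, x - y |> = <| z, x |> - <| z, y |>.
Proof. by rewrite l2_innerC l2_innerBl !(l2_innerC _ z). Qed.

Lemma l2_inner_suml (I : Type) (s : seq I) (P : pred I) (F : I -> l2 f r) z :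
  <| \sum_(i <- s | P i) F i, z |> = \sum_(i <- s | P i) <| F i, z |>.
Proof.
elim/big_rec2: _ => [|i a b _ <-]; first exact: l2_inner0l.
by rewrite l2_innerDl.
Qed.

Lemma l2_inner_sumr (I : Type) (s : seq I) (P : pred I) (F : I -> l2 f r) z :
  <| z, \sum_(i <- s | P i) F i |> = \sum_(i <- s | P i) <| z, F i |>.
Proof.
by rewrite l2_innerC l2_inner_suml; apply: eq_bigr => i _; rewrite l2_innerC.
Qed.

Lemma sqr_l2_norm x : `|x| ^+ 2 = <| x, x |>.
Proof. by rewrite l2_normE sqr_sqrtr// l2_inner_ge0. Qed.

Lemma l2_inner_gt0 x : x != 0 -> 0 < <| x, x |>.
Proof.
move=> x0; rewrite lt_neqAle l2_inner_ge0 andbT eq_sym.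
by apply: contra_neq x0 => /l2_inner_eq0.
Qed.

Lemma l2_cauchy_schwarz_norm x y : `|<| x, y |>| <= `|x| * `|y|.
Proof.
rewrite -(@ler_pXn2r _ 2)// ?nnegrE ?mulr_ge0// real_normK ?num_real//.
by rewrite exprMn !sqr_l2_norm l2_cauchy_schwarz.
Qed.

Lemma weighted_seriesE (x : nat -> R) N :
  series (weighted_prod f r x x) N = \sum_(i < N) f i `^ r * x i ^+ 2.
Proof.
rewrite /series /= big_mkord; apply: eq_bigr => i _.
by rewrite /weighted_prod expr2 mulrA.
Qed.

Lemma weighted_sum_le x N : \sum_(i < N) f i `^ r * x i ^+ 2 <= <| x, x |>.
Proof.
rewrite -weighted_seriesE.
apply: nondecreasing_cvgn_le; last exact: l2_prod_cvg (valP x) (valP x).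
by apply: nondecreasing_series => i _ _; exact: weighted_sq_ge0.
Qed.

Lemma l2_inner_cvg x :
  (fun N => \sum_(i < N) f i `^ r * x i ^+ 2) @ \oo --> <| x, x |>.
Proof.
under eq_fun do rewrite -weighted_seriesE.
exact: l2_prod_cvg (valP x) (valP x).
Qed.

Lemma l2_inner_le x c :
  (forall N, \sum_(i < N) f i `^ r * x i ^+ 2 <= c) -> <| x, x |> <= c.
Proof.
move=> xc; rewrite -(cvg_lim _ (l2_inner_cvg (x := x)))//.
by apply: limr_le; [apply: cvgP; exact: l2_inner_cvg|exact: nearW].
Qed.

Lemma l2_pred_bounded (x : nat -> R) c :
  (forall N, \sum_(i < N) f i `^ r * x i ^+ 2 <= c) -> x \in l2_pred f r.
Proof.
move=> xc; rewrite inE /=; apply: nondecreasing_is_cvgn.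
  by apply: nondecreasing_series => i _ _; exact: weighted_sq_ge0.
by exists c => _ [N _ <-]; rewrite weighted_seriesE.
Qed.

Definition dirac_seq (n : nat) : nat -> R := fun i => (i == n)%:R.

Lemma dirac_seq_l2 n : dirac_seq n \in l2_pred f r.
Proof.
apply: (@l2_pred_bounded _ (f n `^ r)) => N.
have [nN|Nn] := ltnP n N.
  rewrite (bigD1 (Ordinal nN))//= big1 ?addr0.
    by rewrite /dirac_seq eqxx expr1n mulr1.
  move=> i; rewrite -val_eqE /= /dirac_seq => /negPf ->.
  by rewrite expr0n mulr0.
rewrite big1 ?powR_ge0// => i _; rewrite /dirac_seq.
by rewrite (ltn_eqF (leq_trans (ltn_ord i) Nn)) expr0n mulr0.
Qed.

Definition dirac_l2 n : l2 f r := L2 (dirac_seq_l2 n).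

Lemma l2_inner_cvg2 x y :
  (fun N => \sum_(i < N) f i `^ r * x i * y i) @ \oo --> <| x, y |>.
Proof.
have -> : (fun N => \sum_(i < N) f i `^ r * x i * y i) =
    series (weighted_prod f r x y).
  by apply/funext => N; rewrite /series /= big_mkord.
exact: l2_prod_cvg (valP x) (valP y).
Qed.

Lemma l2_inner_dirac x n : <| x, dirac_l2 n |> = f n `^ r * x n.
Proof.
rewrite -(cvg_lim _ (@l2_inner_cvg2 x (dirac_l2 n)))//.
apply: cvg_lim => //; apply: cvg_near_cst.
exists n.+1 => //= N /= nN; rewrite (bigD1 (Ordinal nN))//= big1 ?addr0.
  by rewrite /dirac_seq eqxx mulr1.
by move=> i; rewrite -val_eqE /= /dirac_seq => /negPf ->; rewrite mulr0.
Qed.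

Lemma l2_valD x y n : (x + y : l2 f r) n = x n + y n.
Proof. by []. Qed.

Lemma l2_valZ a x n : (a *: x : l2 f r) n = a * x n.
Proof. by []. Qed.

Lemma l2_val_sum (I : Type) (s : seq I) (P : pred I) (F : I -> l2 f r) n :
  (\sum_(i <- s | P i) F i : l2 f r) n = \sum_(i <- s | P i) F i n.
Proof. by elim/big_rec2: _ => [//|i a b _ <-]; rewrite l2_valD. Qed.

Lemma l2_head (x : l2 f r) n : (forall i, (n <= i)%N -> x i = 0) ->
  <| x, x |> = \sum_(i < n) f i `^ r * x i ^+ 2.
Proof.
move=> x0; rewrite -(cvg_lim _ (l2_inner_cvg (x := x)))//.
apply: cvg_lim => //; apply: cvg_near_cst.
exists n => //= N /= nN; rewrite -!(big_mkord xpredT (fun i => f i `^ r * x i ^+ 2)).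
rewrite (big_cat_nat (n := n))//= [X in _ + X]big_nat_cond [X in _ + X]big1 ?addr0//.
by move=> i /andP[/andP[ni _] _]; rewrite x0// expr0n mulr0.
Qed.

End InnerProduct.

Section Comparison.
Variables (R : realType) (h : growth_fun R).
Local Notation H r := (l2 h r).
Local Notation "<| x , y |>_ r" := (@l2_inner R h r x y)
  (at level 0, x, y at level 99, r at level 0).
Local Notation inc := (@incl10 R h).

Lemma incl10_inj : injective inc.
Proof. by move=> x y /(congr1 (@l2_val _ _ _)) xy; exact: val_inj. Qed.

Lemma weighted_sum0 (x : nat -> R) N :
  \sum_(i < N) h i `^ 0 * x i ^+ 2 = \sum_(i < N) x i ^+ 2.
Proof. by apply: eq_bigr => i _; rewrite powRr0 mul1r. Qed.

Lemma weighted_sum1 (x : nat -> R) N :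
  \sum_(i < N) h i `^ 1 * x i ^+ 2 = \sum_(i < N) h i * x i ^+ 2.
Proof. by apply: eq_bigr => i _; rewrite powRr1// growth_ge0. Qed.

(** Beyond index N the weight is at least h(N), so the tail has H 0-mass at most |x|_1^2 / h(N). As
    h is unbounded this is the compactness of the inclusion in quantitative form; N = 0 gives its
    boundedness. *)
Lemma l2_tail_le (x : H 1) N :
  <| inc x, inc x |>_0 <= \sum_(i < N) x i ^+ 2 + (h N)^-1 * <| x, x |>_1.
Proof.
have hN := growth_gt0 h N.
apply: l2_inner_le => M; rewrite weighted_sum0.
have [MN|NM] := leqP M N.
  apply: ler_wpDr; first by rewrite mulr_ge0 ?invr_ge0 ?(ltW hN) ?l2_inner_ge0.
  rewrite -!(big_mkord xpredT (fun i => x i ^+ 2)) (big_cat_nat (n := M) _ MN)//=.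
  by rewrite lerDl sumr_ge0// => i _; rewrite sqr_ge0.
rewrite -!(big_mkord xpredT (fun i => x i ^+ 2)) (big_cat_nat (n := N) _ (ltnW NM))//=.
rewrite lerD2l ler_pdivlMl// mulr_sumr.
apply: le_trans (weighted_sum_le x M); rewrite weighted_sum1.
rewrite -!(big_mkord xpredT (fun i => h i * x i ^+ 2)).
rewrite (big_cat_nat (m := 0%N) (n := N) _ (ltnW NM))//=.
apply: ler_wpDl.
  by apply: sumr_ge0 => i _; rewrite mulr_ge0 ?sqr_ge0 ?growth_ge0.
rewrite !big_nat; apply: ler_sum => i /andP[Ni _].
by rewrite ler_wpM2r ?sqr_ge0// growth_nd.
Qed.

(** This and [l2_head_le] are the two sides of the min-max comparison: a space of codimension n
    here, one of dimension n + 1 there, so that both constants are h(n). *)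
Lemma l2_tail (x : H 1) n : (forall i, (i < n)%N -> x i = 0) ->
  h n * <| inc x, inc x |>_0 <= <| x, x |>_1.
Proof.
move=> x0; rewrite -ler_pdivlMl ?growth_gt0//.
apply: le_trans (l2_tail_le x n) _; rewrite big1 ?add0r//.
by move=> i _; rewrite x0// expr0n.
Qed.

Lemma l2_head_le (x : H 1) n : (forall i, (n < i)%N -> x i = 0) ->
  <| x, x |>_1 <= h n * <| inc x, inc x |>_0.
Proof.
move=> x0; rewrite (l2_head (n := n.+1))// weighted_sum1.
apply: le_trans (_ : h n * \sum_(i < n.+1) x i ^+ 2 <= _).
  rewrite mulr_sumr; apply: ler_sum => i _.
  by rewrite ler_wpM2r ?sqr_ge0// growth_nd// -ltnS.
rewrite ler_pM2l ?growth_gt0//.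
by have := weighted_sum_le (inc x) n.+1; rewrite weighted_sum0.
Qed.

End Comparison.

Lemma cvg_finite_sum (R : realType) (T : Type) (F : set_system T)
    (FF : Filter F) (N : nat) (u : nat -> T -> R) (l : nat -> R) :
  (forall i, u i t @[t --> F] --> l i) ->
  \sum_(i < N) u i t @[t --> F] --> \sum_(i < N) l i.
Proof.
move=> ul; elim: N => [|N IH].
  under eq_fun do rewrite big_ord0.
  by rewrite big_ord0; exact: cvg_cst.
under eq_fun do rewrite big_ord_recr.
by rewrite big_ord_recr; apply: cvgD; [exact: IH|exact: ul].
Qed.

Section Completeness.
Variables (R : realType) (f : growth_fun R) (r : R).
Local Notation "<| x , y |>" := (@l2_inner R f r x y)
  (at level 0, x, y at level 99).

(** Finite sums pass to the limit. The conclusion speaks of partial sums because the limit x is only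
    a sequence, whose membership in l^2 is usually deduced from it. *)
Lemma l2_fatou (T : Type) (F : set_system T) (FF : ProperFilter F)
    (u : T -> l2 f r) (x : nat -> R) c :
  (forall i, u t i @[t --> F] --> x i) ->
  (\forall t \near F, <| u t, u t |> <= c) ->
  forall N, \sum_(i < N) f i `^ r * x i ^+ 2 <= c.
Proof.
move=> ux uc N.
apply: (@cvgr_to_le _ F FF _ (fun t => \sum_(i < N) f i `^ r * u t i ^+ 2)).
  apply: (@cvg_finite_sum _ _ _ _ N (fun i t => f i `^ r * u t i ^+ 2)
    (fun i => f i `^ r * x i ^+ 2)) => i; apply: cvgM; first exact: cvg_cst.
  exact: (cvgM (ux i) (ux i)).
by near=> t; apply: le_trans (weighted_sum_le _ _) _; near: t.
Unshelve. all: by end_near. Qed.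

Lemma l2_coord_le (x : l2 f r) i : `|x i| <= (Num.sqrt (f i `^ r))^-1 * `|x|.
Proof.
have w0 := weight_gt0 f r i.
rewrite ler_pdivlMl ?sqrtr_gt0// l2_normE -sqrtr_sqr -sqrtrM ?(ltW w0)//.
rewrite ler_wsqrtr// expr2 mulrA; exact: l2_inner_ge.
Qed.

(** Coordinates are bounded functionals, so a Cauchy filter has a coordinatewise limit, and
    [l2_fatou] makes it a norm limit. Completeness is what Banach-Steinhaus and the contraction
    principle need later. *)
Lemma l2_complete (F : set_system (l2 f r)) :
  ProperFilter F -> cauchy F -> cvg F.
Proof.
move=> FF Fc.
have Fe : cauchy_ex F by exact/cauchyP.
have coord i : exists l : R, (y i @[y --> F]) --> l.
  suff : cvg (y i @[y --> F]) by move=> yc; exists (lim (y i @[y --> F])).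
  apply/cauchy_cvgP.
  apply: cauchy_exP => e e0.
  have w0 : 0 < Num.sqrt (f i `^ r) by rewrite sqrtr_gt0 weight_gt0.
  have [z Fz] := Fe _ (mulr_gt0 w0 e0); exists (z i).
  rewrite /nbhs /=; apply: filterS Fz => y.
  rewrite -!ball_normE /ball_ /= => zy.
  rewrite -[_ - _]/((z - y) i); apply: le_lt_trans (l2_coord_le _ _) _.
  by rewrite ltr_pdivrMl.
pose x i := xget 0 [set l : R | (y i @[y --> F]) --> l].
have xP i : (y i @[y --> F]) --> x i.
  exact: (@xgetPex _ 0 _ (coord i)).
have near_le (e : R) : 0 < e -> exists2 z : l2 f r, F (ball z e) &
    forall N, \sum_(i < N) f i `^ r * (x i - z i) ^+ 2 <= e ^+ 2.
  move=> e0; have [z Fz] := Fe _ e0; exists z => //.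
  apply: (@l2_fatou _ F FF (fun y => y - z) (fun i => x i - z i)).
    by move=> i; apply: cvgB; [exact: xP|exact: cvg_cst].
  apply: filterS Fz => y; rewrite -ball_normE /ball_ /= => zy.
  rewrite -sqr_l2_norm ler_pXn2r ?nnegrE ?(ltW e0)// distrC; exact: ltW.
(* x itself is not bounded directly: x - z is square summable for some z in the space. *)
have xl2 : x \in l2_pred f r.
  have [z _ zP] := near_le 1 ltr01.
  have dl2 := l2_pred_bounded (x := fun i => x i - z i) zP.
  have -> : x = (L2 dl2 + z : l2 f r).
    by apply/funext => i; rewrite l2_valD /= subrK.
  exact: valP.
apply: (@cvgP _ _ (L2 xl2)); apply/cvgrPdist_le => e e0.
have e2 : 0 < e / 2 by rewrite divr_gt0.
have [z Fz zP] := near_le _ e2.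
rewrite /nbhs /=; apply: filterS Fz => y.
rewrite -ball_normE /ball_ /= => zy.
rewrite -(subrK z (L2 xl2)) -addrA (le_trans (ler_normD _ _))//.
rewrite (splitr e) lerD ?(ltW zy)//.
rewrite -(@ler_pXn2r _ 2)// ?nnegrE ?(ltW e2)// sqr_l2_norm.
exact: l2_inner_le.
Qed.

HB.instance Definition _ := Uniform_isComplete.Build (l2 f r) l2_complete.

End Completeness.

(** * Compact symmetric operators *)

(** Ultrafilters replace subsequences: all coordinates of a bounded family converge along the same
    ultrafilter, without a diagonal extraction. In a compact segment there is a cluster point, and
    for an ultrafilter it is a limit. *)
Lemma ultra_bounded_cvg (R : realType) (T : Type) (F : set_system T)
    (a : T -> R) (c : R) :
  UltraFilter F -> (\forall t \near F, `|a t| <= c) ->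
  exists l : R, a t @[t --> F] --> l.
Proof.
move=> FU ac; have FF : ProperFilter F by case: FU.
have [|l [_ lP]] := @segment_compact R (- c) c (a @ F) _.
  by near do rewrite /= in_itv /= -ler_norml.
exists l => B lB.
have [//|FB] := in_ultra_setVsetC (a @^-1` B) FU.
have aB : F (a @^-1` (a @` (~` (a @^-1` B)))) by apply: filterS FB => t Bt; exists t.
by have [_ [[t Bt <-] Bat]] := lP _ _ aB lB.
Unshelve. all: by end_near. Qed.

Lemma quadratic_ge0_linear0 (R : realType) (a b : R) :
  (forall t, 0 <= 2 * t * b + t ^+ 2 * a) -> b = 0.
Proof.
move=> H; have a0 : 0 <= a by have := H 1; have := H (-1); lra.
have a1 : 0 < a + 1 by lra.
(* The minimiser would be - b / a; a + 1 also covers a = 0 and still makes the value negative unless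
   b = 0. *)
have := H (- b / (a + 1)).
have -> : 2 * (- b / (a + 1)) * b + (- b / (a + 1)) ^+ 2 * a =
  - (b ^+ 2 * (a + 2) / (a + 1) ^+ 2) by field; rewrite gt_eqF.
rewrite oppr_ge0 pmulr_lle0 ?invr_gt0 ?exprn_gt0// pmulr_lle0; last by lra.
by move=> b0; apply/eqP; rewrite -sqrf_eq0 eq_le b0 sqr_ge0.
Qed.

Section Compactness.
Variables (R : realType) (h : growth_fun R).
Local Notation H r := (l2 h r).
Local Notation "<| x , y |>_ r" := (@l2_inner R h r x y)
  (at level 0, x, y at level 99, r at level 0).
Local Notation inc := (@incl10 R h).

Lemma l2_inner_dirac0 (x : H 0) n : <| x, dirac_l2 h 0 n |>_0 = x n.
Proof. by rewrite l2_inner_dirac powRr0 mul1r. Qed.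

Lemma l2_inner_add_le (f : growth_fun R) r (x y : l2 f r) :
  l2_inner (x + y) (x + y) <= 2 * l2_inner x x + 2 * l2_inner y y.
Proof.
rewrite !l2_innerDl !l2_innerDr (l2_innerC y x).
have := l2_inner_ge0 (x - y); rewrite !l2_innerBl !l2_innerBr (l2_innerC y x).
lra.
Qed.

Definition head_l2 r (x : nat -> R) N : H r :=
  \sum_(i < N) x i *: dirac_l2 h r i.

Lemma head_l2E r x N i : head_l2 r x N i = if (i < N)%N then x i else 0.
Proof.
have -> : head_l2 r x N i = \sum_(j < N) x j * (i == j)%:R.
  by rewrite /head_l2 l2_val_sum; apply: eq_bigr => j _; rewrite l2_valZ.
case: ltnP => iN.
  rewrite (bigD1 (Ordinal iN))//= eqxx mulr1 big1 ?addr0// => j.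
  by rewrite -val_eqE /= eq_sym => /negPf ->; rewrite mulr0.
rewrite big1// => j _.
by rewrite (gtn_eqF (leq_trans (ltn_ord j) iN)) mulr0.
Qed.

Lemma head_l2_sq r (x : nat -> R) N :
  <| head_l2 r x N, head_l2 r x N |>_r = \sum_(i < N) h i `^ r * x i ^+ 2.
Proof.
rewrite (l2_head (n := N)); last by move=> i Ni; rewrite head_l2E ltnNge Ni.
by apply: eq_bigr => i _; rewrite head_l2E ltn_ord.
Qed.

Lemma head_l2_cvg (w : H 0) e : 0 < e ->
  exists N, <| w - head_l2 0 w N, w - head_l2 0 w N |>_0 <= e.
Proof.
move=> e0; have /cvgrPdist_le /(_ _ e0) [N _ NP] := @l2_inner_cvg _ _ _ w.
exists N; have /= := NP N (leqnn N); apply: le_trans.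
rewrite -head_l2_sq; set wN := head_l2 0 w N.
have wN_w : <| w, wN |>_0 = <| wN, wN |>_0.
  rewrite head_l2_sq l2_inner_sumr; apply: eq_bigr => i _.
  by rewrite l2_innerZr l2_inner_dirac0 powRr0 mul1r expr2.
rewrite !l2_innerBl !l2_innerBr (l2_innerC wN w) wN_w subrr subr0.
exact: ler_norm.
Qed.

(** Against a truncation of w only finitely many coordinates matter; the remainder of w is small,
    and Cauchy-Schwarz with the bound c controls its contribution. *)
Lemma weak_cvg (T : Type) (F : set_system T) (FF : ProperFilter F)
    (u : T -> H 0) (y w : H 0) c :
  (forall i, u t i @[t --> F] --> y i) ->
  (\forall t \near F, <| u t, u t |>_0 <= c) ->
  <| u t, w |>_0 @[t --> F] --> <| y, w |>_0.
Proof.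
move=> uy uc.
have yc : <| y, y |>_0 <= c by apply: l2_inner_le; exact: (l2_fatou FF uy uc).
have c0 : 0 <= c by apply: le_trans yc; exact: l2_inner_ge0.
apply/cvgrPdist_le => e e0.
have K0 : 0 < 4 * c + 1 by lra.
(* Here 4 c bounds the squared norm of y - u t, and the added 1 keeps the denominator positive when
   c = 0. *)
have [|N] := @head_l2_cvg w ((e / 2) ^+ 2 / (4 * c + 1)).
  by rewrite divr_gt0// exprn_gt0// divr_gt0.
set wN := head_l2 0 w N => wNP.
have uN : <| u t, wN |>_0 @[t --> F] --> <| y, wN |>_0.
  rewrite l2_inner_sumr; under eq_fun do rewrite l2_inner_sumr.
  apply: (@cvg_finite_sum _ _ _ _ N
    (fun i t => <| u t, w i *: dirac_l2 h 0 i |>_0)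
    (fun i => <| y, w i *: dirac_l2 h 0 i |>_0)) => i.
  rewrite l2_innerZr l2_inner_dirac0.
  under eq_fun do rewrite l2_innerZr l2_inner_dirac0.
  by apply: cvgM; [exact: cvg_cst|exact: uy].
have e2 : 0 < e / 2 by rewrite divr_gt0.
near=> t.
rewrite -l2_innerBl -(subrK wN w) l2_innerDr (le_trans (ler_normD _ _))//.
rewrite (splitr e) lerD//; last first.
  rewrite l2_innerBl; near: t.
  by move/cvgrPdist_le : uN => /(_ _ e2).
rewrite -(@ler_pXn2r _ 2)// ?nnegrE ?(ltW e2)// real_normK ?num_real//.
apply: le_trans (l2_cauchy_schwarz _ _) _.
have ut : <| u t, u t |>_0 <= c by near: t.
have yu : <| y - u t, y - u t |>_0 <= 4 * c.
  apply: le_trans (l2_inner_add_le _ _) _.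
  by rewrite l2_innerNl l2_innerC l2_innerNl opprK; lra.
apply: le_trans (_ : 4 * c * ((e / 2) ^+ 2 / (4 * c + 1)) <= _).
  by apply: ler_pM => //; exact: l2_inner_ge0.
rewrite mulrCA ger_pMr ?exprn_gt0// ler_pdivrMr// mul1r; lra.
Unshelve. all: by end_near. Qed.

(** Rellich compactness: finitely many coordinates converge, and the H 1-bound makes the tails
    uniformly small in H 0 by [l2_tail_le]. *)
Lemma compact_cvg (T : Type) (F : set_system T) (FF : ProperFilter F)
    (u : T -> H 1) (x : H 1) c :
  (forall i, u t i @[t --> F] --> x i) ->
  (\forall t \near F, <| u t, u t |>_1 <= c) ->
  inc (u t) @[t --> F] --> inc x.
Proof.
move=> ux uc.
have xc : <| x, x |>_1 <= c by apply: l2_inner_le; exact: (l2_fatou FF ux uc).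
apply/cvgrPdist_le => e e0.
have e2 : 0 < e ^+ 2 / 2 by rewrite divr_gt0// exprn_gt0.
have [N hN] := growth_unbounded h (4 * c / (e ^+ 2 / 2)).
have uN : \sum_(i < N) (x i - u t i) ^+ 2 @[t --> F] --> (0 : R).
  have xu i : (x i - u t i) ^+ 2 @[t --> F] --> (0 : R).
    have xu : x i - u t i @[t --> F] --> (0 : R).
      by rewrite -(subrr (x i)); apply: cvgB; [exact: cvg_cst|exact: ux].
    by rewrite -(mulr0 0); exact: (cvgM xu xu).
  have := cvg_finite_sum (N := N) FF xu.
  by rewrite big1_eq.
near=> t.
rewrite -linearB -(@ler_pXn2r _ 2)// ?nnegrE ?(ltW e0)// sqr_l2_norm.
apply: le_trans (l2_tail_le _ N) _.
rewrite (splitr (e ^+ 2)) lerD//.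
  have : `|0 - \sum_(i < N) (x i - u t i) ^+ 2| <= e ^+ 2 / 2.
    by near: t; move/cvgrPdist_le : uN => /(_ _ e2).
  by rewrite sub0r normrN; apply: le_trans; exact: ler_norm.
rewrite ler_pdivrMl ?growth_gt0//.
have ut : <| u t, u t |>_1 <= c by near: t.
apply: le_trans (_ : 4 * c <= _); last by rewrite -ler_pdivrMr// ltW.
apply: le_trans (l2_inner_add_le _ _) _.
by rewrite l2_innerNl l2_innerC l2_innerNl opprK; lra.
Unshelve. all: by end_near. Qed.

End Compactness.

Section HellingerToeplitz.
Variables (R : realType) (h : growth_fun R).
Local Notation H r := (l2 h r).
Local Notation "<| x , y |>_ r" := (@l2_inner R h r x y)
  (at level 0, x, y at level 99, r at level 0).
Local Notation inc := (@incl10 R h).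

Variable S : {linear H 0 -> H 1}.
Hypothesis S_sym : forall x y, <| inc (S x), y |>_0 = <| x, inc (S y) |>_0.

Lemma symmetric_coord (x : H 0) i :
  S x i = <| x, inc (S (dirac_l2 h 0 i)) |>_0.
Proof. by rewrite -S_sym l2_inner_dirac0. Qed.

(* Hellinger-Toeplitz: the truncations of S are bounded because each          *)
(* coordinate of S x is the inner product of x with S e_i, and they converge  *)
(* pointwise to S, so Banach-Steinhaus applies.                               *)
Lemma symmetric_bounded : bounded_op S.
Proof.
pose T N (x : H 0) : H 1 := head_l2 h 1 (S x) N.
have [M MP] : exists M, forall N x, `|x| <= 1 -> `|T N x| <= M.
  have [||M MP] := @Banach_Steinhauss R (H 0) (H 1) (range T) _ _ 1.
  - move=> _ [N _ <-]; split.
      move=> s; exists (\sum_(i < N)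
        `|s| * `|inc (S (dirac_l2 h 0 i))| * `|dirac_l2 h 1 i|).
      move=> x xs; apply: le_trans (ler_norm_sum _ _ _) _.
      apply: ler_sum => i _; rewrite normrZ ler_wpM2r//.
      rewrite symmetric_coord (le_trans (l2_cauchy_schwarz_norm _ _))//.
      by rewrite ler_wpM2r// (le_trans xs)// ler_norm.
    move=> a x y; apply: val_inj; apply/funext => i.
    rewrite -[LHS]/(T N (a *: x + y) i) -[RHS]/((a *: T N x + T N y) i).
    rewrite l2_valD l2_valZ !head_l2E.
    have -> : S (a *: x + y) = a *: S x + S y by exact: linearP.
    by rewrite l2_valD l2_valZ; case: ifP => // _; rewrite mulr0 addr0.
  - move=> x; exists `|S x| => _ [N _ <-].
    rewrite -(@ler_pXn2r _ 2)// ?nnegrE// !sqr_l2_norm head_l2_sq.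
    exact: weighted_sum_le.
  by exists M => N x x1; apply: (MP (T N)) => //; exists N.
have M0 : 0 <= M by apply: le_trans (MP 0%N 0 _); rewrite ?normr0.
have S1 (x : H 0) : `|x| <= 1 -> `|S x| <= M.
  move=> x1; rewrite -(@ler_pXn2r _ 2)// ?nnegrE// sqr_l2_norm.
  apply: l2_inner_le => N; rewrite -head_l2_sq -sqr_l2_norm.
  by rewrite ler_pXn2r// ?nnegrE// MP.
exists M => x; have [->|x0] := eqVneq x 0.
  by rewrite linear0 !normr0 mulr0.
have x0' : 0 < `|x| by rewrite normr_gt0.
rewrite -ler_pdivrMr// mulrC -[`|x|^-1]ger0_norm ?invr_ge0// -normrZ -linearZ.
by apply: S1; rewrite normrZ ger0_norm ?invr_ge0// mulVf// gt_eqF.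
Qed.

End HellingerToeplitz.

Section CompactSymmetric.
Variables (R : realType) (h : growth_fun R).
Local Notation H r := (l2 h r).
Local Notation "<| x , y |>_ r" := (@l2_inner R h r x y)
  (at level 0, x, y at level 99, r at level 0).
Local Notation inc := (@incl10 R h).

Variable S : {linear H 0 -> H 1}.
Hypothesis S_sym : forall x y, <| inc (S x), y |>_0 = <| x, inc (S y) |>_0.
Hypothesis S_bnd : bounded_op S.
Variables (I : Type) (u : I -> H 0).

Let orth (y : H 0) := forall i, <| y, u i |>_0 = 0.
Let K (y : H 0) : H 0 := inc (S y).

Let KD x y : K (x + y) = K x + K y.
Proof. by rewrite /K !linearD. Qed.
Let KZ a x : K (a *: x) = a *: K x.
Proof. by rewrite /K linearZ linearZ. Qed.

(* The maximum is attained at the coordinatewise limit of a maximising        *)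
(* sequence along an ultrafilter: S turns this weak convergence into norm     *)
(* convergence in H 0.                                                        *)
Lemma symmetric_compact_max : exists y, [/\ orth y, <| y, y |>_0 <= 1 &
  forall z, orth z -> <| z, z |>_0 <= 1 -> <| K z, K z |>_0 <= <| K y, K y |>_0].
Proof.
pose E := [set <| K z, K z |>_0 | z in [set z | orth z /\ <| z, z |>_0 <= 1]].
have [C C0 SC] : exists2 C, 0 <= C &
    forall z, <| z, z |>_0 <= 1 -> <| S z, S z |>_1 <= C.
  have [C SC] := S_bnd; exists (C ^+ 2); first exact: sqr_ge0.
  move=> z z1; rewrite -sqr_l2_norm.
  have : `|S z| ^+ 2 <= (C * `|z|) ^+ 2.
    by rewrite ler_pXn2r ?nnegrE// (le_trans _ (SC z)).
  move=> /le_trans; apply; rewrite exprMn sqr_l2_norm.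
  by rewrite ler_piMr ?sqr_ge0.
have supE : has_sup E.
  split; first by exists (<| K 0, K 0 |>_0), 0 => //; split => [i|]; rewrite l2_inner0l.
  exists ((h 0)^-1 * C) => _ [z [_ z1] <-].
  apply: le_trans (l2_tail_le _ 0) _; rewrite big_ord0 add0r.
  by rewrite ler_wpM2l ?invr_ge0 ?growth_ge0// SC.
have /choice[y yP] : forall k : nat, exists z, [/\ orth z, <| z, z |>_0 <= 1 &
    sup E - k.+1%:R^-1 <= <| K z, K z |>_0].
  move=> k; have [|_ [z [oz z1] <-] zE] := sup_adherent (eps := k.+1%:R^-1) _ supE.
    by rewrite invr_gt0.
  by exists z; split => //; exact: ltW.
have [U [UU UF]] := ultraFilterLemma (T := nat) (F := \oo) _.
have FU : ProperFilter U by case: UU.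
have /choice[x xP] : forall i, exists l : R, y t i @[t --> U] --> l.
  move=> i; apply: (@ultra_bounded_cvg _ _ _ _ 1) => //.
  apply: nearW => t; apply: le_trans (l2_coord_le _ _) _.
  rewrite powRr0 sqrtr1 invr1 mul1r -(@ler_pXn2r _ 2)// ?nnegrE// sqr_l2_norm.
  by rewrite expr1n; have [] := yP t.
have y1 : \forall t \near U, <| y t, y t |>_0 <= 1.
  by apply: nearW => t; have [] := yP t.
have x1 := l2_fatou FU xP y1.
pose Y : H 0 := L2 (l2_pred_bounded x1).
have yY w : <| y t, w |>_0 @[t --> U] --> <| Y, w |>_0 by exact: weak_cvg y1.
have KY : K (y t) @[t --> U] --> K Y.
  apply: (@compact_cvg _ _ _ _ FU (fun t => S (y t)) _ C).
    (* Coordinate i of S z is the inner product of z with S e_i, so weak convergence of y t gives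
       coordinatewise convergence of S (y t). *)
    move=> i; rewrite symmetric_coord//; under eq_fun do rewrite symmetric_coord//.
    exact: yY.
  by apply: nearW => t; apply: SC; have [] := yP t.
have KY2 : <| K (y t), K (y t) |>_0 @[t --> U] --> <| K Y, K Y |>_0.
  rewrite -sqr_l2_norm expr2; under eq_fun do rewrite -sqr_l2_norm expr2.
  by apply: cvgM; exact: cvg_norm KY.
exists Y; split.
- move=> i; have yu : (fun t => <| y t, u i |>_0) = cst 0.
    by apply/funext => t; have [-> _ _] := yP t.
  have := yY (u i); rewrite yu => /(cvg_lim (@Rhausdorff R)) <-.
  exact: (lim_cst (@Rhausdorff R)).
- exact: l2_inner_le.
- move=> z oz z1; apply: (@le_trans _ _ (sup E)).
    by apply: ub_le_sup; [case: supE|exists z].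
  apply/ler_addgt0Pr => e e0; rewrite -lerBlDr.
  apply: (@cvgr_to_ge _ U FU _ _ _ _ KY2).
  have : \forall k \near \oo, sup E - e <= <| K (y k), K (y k) |>_0.
    near=> k; have [_ _] := yP k; apply: le_trans; rewrite lerD2l lerN2.
    by apply: ltW; near: k; exact: (near_infty_natSinv_lt (PosNum e0)).
  exact: UF.
Unshelve. all: by end_near. Qed.

(* At a maximiser y of |K y| with maximal value M of |K y|^2, the first       *)
(* variation gives K (K y) = M y; then K y + sqrt M y, or y itself if that    *)
(* vanishes, is an eigenvector of K.                                          *)
Lemma symmetric_compact_eigen (s : I -> R) z0 m :
  (forall i, K (u i) = s i *: u i) -> orth z0 -> z0 != 0 -> 0 < m ->
  m * <| z0, z0 |>_0 <= <| K z0, K z0 |>_0 ->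
  exists (w : H 0) (sg : R), [/\ w != 0, orth w, K w = sg *: w & m <= sg ^+ 2].
Proof.
move=> Ku oz0 z00 m0 mz0.
have [y [oy y1 ymax]] := symmetric_compact_max.
set M := <| K y, K y |>_0 in ymax.
have KK z : orth z -> <| K z, K z |>_0 <= M * <| z, z |>_0.
  move=> oz; have [->|zn0] := eqVneq z 0.
    by rewrite /K !linear0 !l2_inner0l mulr0.
  have zp : 0 < `|z| by rewrite normr_gt0.
  have := ymax (`|z|^-1 *: z); rewrite KZ !l2_innerZl !l2_innerZr.
  rewrite -(sqr_l2_norm z) expr2 mulrCA mulKf ?gt_eqF// mulVf ?gt_eqF//.
  rewrite lexx mulrA -invfM mulrC -ler_pdivlMr ?invr_gt0 ?mulr_gt0// invrK.
  by apply => // i; rewrite l2_innerZl oz mulr0.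
have mM : m <= M.
  rewrite -(ler_pM2r (l2_inner_gt0 z00)); apply: le_trans mz0 _; exact: KK.
have M0 : 0 < M by exact: lt_le_trans mM.
(* The form M |x|^2 - |K x|^2 is nonnegative on the orthogonal complement and at most 0 at y, so its
   first variation at y vanishes. *)
have polar z : orth z -> M * <| y, z |>_0 - <| K y, K z |>_0 = 0.
  move=> oz.
  apply: (@quadratic_ge0_linear0 _ (M * <| z, z |>_0 - <| K z, K z |>_0)) => t.
  have := KK (y + t *: z); rewrite KD KZ.
  rewrite !(l2_innerDl, l2_innerDr, l2_innerZl, l2_innerZr).
  rewrite (l2_innerC z y) (l2_innerC (K z)) -/M => /(_ _)/wrap[].
    by move=> i; rewrite l2_innerDl l2_innerZl oy oz mulr0 addr0.
  have : M * <| y, y |>_0 <= M by rewrite ger_pMr.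
  lra.
have Ksym a b : <| K a, b |>_0 = <| a, K b |>_0 by exact: S_sym.
have oK z : orth z -> orth (K z).
  by move=> oz i; rewrite Ksym Ku l2_innerZr oz mulr0.
have KKy : K (K y) = M *: y.
  apply/esym/eqP; rewrite -subr_eq0; apply/eqP/l2_inner_eq0.
  (* The first variation is tested on z = M y - K (K y) itself, which gives |z|^2 = 0. *)
  rewrite {1}l2_innerBl l2_innerZl Ksym; apply: polar => i.
  by rewrite l2_innerBl l2_innerZl oy (oK _ (oK _ oy)) mulr0 subr0.
have y0 : y != 0.
  by apply/eqP => y0; move: M0; rewrite /M y0 /K !linear0 l2_inner0l ltxx.
have sqM : Num.sqrt M ^+ 2 = M by rewrite sqr_sqrtr// ltW.
have [w0|w0] := eqVneq (K y + Num.sqrt M *: y) 0.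
  exists y, (- Num.sqrt M); split => //; last by rewrite sqrrN sqM.
  by rewrite scaleNr; apply/eqP; rewrite -addr_eq0 w0.
exists (K y + Num.sqrt M *: y), (Num.sqrt M); split => //; last by rewrite sqM.
  by move=> i; rewrite l2_innerDl l2_innerZl oy (oK _ oy) mulr0 addr0.
by rewrite KD KZ KKy scalerDr scalerA -expr2 sqM addrC.
Qed.

End CompactSymmetric.

(** * Eigenvalue asymptotics *)

(** More unknowns than equations: every dimension count below takes this form. General finite index
    types allow families indexed by ['I_p + 'I_q]. *)
Lemma nontrivial_combination (F : fieldType) (I J : finType) (M : I -> J -> F) :
  (#|J| < #|I|)%N -> exists c : I -> F,
    (exists i, c i != 0) /\ forall j, \sum_i c i * M i j = 0.
Proof.
move=> JI; pose A := \matrix_(i < #|I|, j < #|J|) M (enum_val i) (enum_val j).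
have kA : kermx A != 0.
  by rewrite -mxrank_eq0 mxrank_ker -lt0n subn_gt0 (leq_ltn_trans (rank_leq_col _)).
pose v := nz_row (kermx A).
have v0 : v != 0 by rewrite nz_row_eq0.
have vA : v *m A = 0 by apply/sub_kermxP; exact: nz_row_sub.
exists (fun i => v 0 (enum_rank i)); split.
  have /rV0Pn[i vi] := v0.
  by exists (enum_val i); rewrite enum_valK.
move=> j; have /rowP/(_ (enum_rank j)) := vA; rewrite !mxE => vAj; rewrite -[RHS]vAj.
rewrite (reindex (@enum_rank I))/=; last by apply: onW_bij; exact: enum_rank_bij.
by apply: eq_bigr => i _; rewrite mxE !enum_rankK.
Qed.

Lemma cancel_linear_ker0 (R : pzRingType) (V W : lmodType R)
    (A : {linear V -> W}) (S : {linear W -> V}) :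
  cancel A S -> forall x, A x = 0 -> x = 0.
Proof. by move=> SK x Ax0; rewrite -(SK x) Ax0 linear0. Qed.

Lemma cancel_eigenvector (R : fieldType) (V W : lmodType R)
    (A : {linear V -> W}) (S : {linear W -> V}) (u : V) (w : W) (lam : R) :
  cancel A S -> lam != 0 -> A u = lam *: w -> S w = lam^-1 *: u.
Proof.
move=> SK lam0 Au; rewrite -(SK u) Au linearZ scalerA mulVf// scale1r//.
Qed.

Lemma eq_ler (R : numDomainType) (a b : R) : a = b -> a <= b.
Proof. by move->. Qed.

Lemma inv_le_sqr_neq0 (R : realFieldType) (a b : R) :
  0 < a -> a^-1 <= b ^+ 2 -> b != 0.
Proof.
move=> a0 ab; rewrite -sqrf_eq0 gt_eqF// (lt_le_trans _ ab)// invr_gt0//.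
Qed.

Lemma inv_le_sqr (R : realFieldType) (a b : R) :
  0 < a -> a^-1 <= b ^+ 2 -> b^-1 ^+ 2 <= a.
Proof.
move=> a0 ab; have b0 := inv_le_sqr_neq0 a0 ab.
by rewrite exprVn -[leRHS]invrK lef_pV2 ?posrE ?invr_gt0// exprn_even_gt0.
Qed.

Lemma scaler_swap (R : fieldType) (V : lmodType R) (v w : V) (k : R) :
  k != 0 -> v = k *: w -> w = k^-1 *: v.
Proof. by move=> k0 ->; rewrite scalerA mulVf// scale1r. Qed.

Section Orthonormal.
Variables (R : realType) (h : growth_fun R).
Local Notation H r := (l2 h r).
Local Notation "<| x , y |>_ r" := (@l2_inner R h r x y)
  (at level 0, x, y at level 99, r at level 0).
Local Notation inc := (@incl10 R h).

Lemma incl10D x y : inc (x + y) = inc x + inc y. Proof. exact: linearD. Qed.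

Lemma incl10Z a x : inc (a *: x) = a *: inc x. Proof. exact: linearZ. Qed.

Lemma incl10_comb (I : finType) (u : I -> H 1) (a : I -> R) :
  inc (\sum_i a i *: u i) = \sum_i a i *: inc (u i).
Proof. by rewrite linear_sum; apply: eq_bigr => i _; exact: linearZ. Qed.

Definition orthonormal_family (I : eqType) (u : I -> H 1) :=
  forall i j, <| inc (u i), inc (u j) |>_0 = (i == j)%:R.

Lemma orthonormal_inner (I : finType) (u : I -> H 1) (a b : I -> R) :
  orthonormal_family u ->
  <| \sum_i a i *: inc (u i), \sum_i b i *: inc (u i) |>_0 = \sum_i a i * b i.
Proof.
move=> ou; rewrite l2_inner_suml; apply: eq_bigr => i _.
rewrite l2_innerZl l2_inner_sumr (bigD1 i)//= l2_innerZr ou eqxx mulr1.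
rewrite big1 ?addr0// => j ji.
by rewrite l2_innerZr ou eq_sym (negPf ji) mulr0.
Qed.

Lemma orthonormal_coef (I : finType) (u : I -> H 1) (a : I -> R) i :
  orthonormal_family u -> <| \sum_j a j *: inc (u j), inc (u i) |>_0 = a i.
Proof.
move=> ou; rewrite l2_inner_suml (bigD1 i)//= l2_innerZl ou eqxx mulr1.
rewrite big1 ?addr0// => j ji.
by rewrite l2_innerZl ou (negPf ji) mulr0.
Qed.

(** Instead of projecting as in Gram-Schmidt, each new vector comes from a count: k orthogonality
    conditions cannot kill all combinations of m > k basis vectors. For maximality, x and the m
    vectors u i are dependent in E; pairing with each u i removes its coefficient and leaves a
    nonzero multiple of x equal to 0. *)
Lemma has_dim_orthonormal (E : set (H 1)) m : has_dim E m ->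
  exists u : 'I_m -> H 1, [/\ forall i, E (u i), orthonormal_family u &
    forall x, E x -> (forall i, <| inc x, inc (u i) |>_0 = 0) -> x = 0].
Proof.
move=> [e [ind EE]].
have scaleE a x : E x -> E (a *: x).
  rewrite EE => -[c _ <-]; exists (fun i => a * c i) => //.
  by rewrite scaler_sumr; apply: eq_bigr => i _; rewrite scalerA.
have [u [Eu ou]] : exists u : 'I_m -> H 1, (forall i, E (u i)) /\ orthonormal_family u.
  (* Indexing by [nat] lets the induction extend the family without changing its type. *)
  suff [u uP] : exists u : nat -> H 1, forall i j, (i < m)%N -> (j < m)%N ->
      E (u i) /\ <| inc (u i), inc (u j) |>_0 = (i == j)%:R.
    exists (fun i : 'I_m => u i); split=> [i|i j].
      by have [] := uP i i (ltn_ord i) (ltn_ord i).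
    by have [_ ->] := uP i j (ltn_ord i) (ltn_ord j).
  have : (m <= m)%N by []; move: {1 3 4}m.
  elim=> [|k IH] km; first by exists (fun=> 0).
  have [u uP] := IH (ltnW km).
  have [|c [c0 cu]] := @nontrivial_combination _ 'I_m 'I_k
    (fun i j => <| inc (e i), inc (u j) |>_0); first by rewrite !card_ord.
  pose w := \sum_i c i *: e i.
  have w0 : w != 0.
    by have [i ci] := c0; apply: contra_neq ci => /ind; exact.
  have Ew : E w by rewrite EE; exists c.
  have wu j : (j < k)%N -> <| inc w, inc (u j) |>_0 = 0.
    move=> jk; rewrite -[RHS](cu (Ordinal jk)) linear_sum l2_inner_suml.
    by apply: eq_bigr => i _; rewrite linearZ l2_innerZl.
  have iw0 : inc w != 0.
    by apply: contra_neq w0 => iw; apply: incl10_inj; rewrite iw linear0.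
  have iwp : 0 < `|inc w| by rewrite normr_gt0.
  exists (fun i => if i == k then `|inc w|^-1 *: w else u i) => i j.
  have ltk l : (l < k.+1)%N -> l != k -> (l < k)%N.
    by rewrite ltnS leq_eqVlt => /predU1P[->|//]; rewrite eqxx.
  have [->|ik] := eqVneq i k; have [->|jk] := eqVneq j k => /= ilt jlt.
  - split; first exact: scaleE.
    rewrite linearZ l2_innerZl l2_innerZr -sqr_l2_norm expr2.
    by rewrite mulKf ?gt_eqF// mulVf ?gt_eqF.
  - split; first exact: scaleE.
    by rewrite linearZ l2_innerZl wu ?ltk// mulr0.
  - split; first by have [] := uP i i (ltk _ ilt ik) (ltk _ ilt ik).
    by rewrite linearZ l2_innerC l2_innerZl wu ?ltk// mulr0 (negPf ik).
  - exact: uP (ltk _ ilt ik) (ltk _ jlt jk).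
exists u; split=> // x Ex xu.
have coord y : E y -> exists c : 'I_m -> R, \sum_i c i *: e i = y.
  by rewrite EE => -[c _ cy]; exists c.
have [a aE] := coord _ Ex.
have /choice[b bE] : forall i, exists c, \sum_j c j *: e j = u i.
  by move=> i; exact: coord.
have [|c [[i ci] cM]] := @nontrivial_combination _ 'I_m.+1 'I_m
  (fun i j => if unlift ord0 i is Some k then b k j else a j).
  by rewrite !card_ord.
have lin : c ord0 *: x + \sum_i c (lift ord0 i) *: u i = 0.
  transitivity (\sum_j
      (\sum_i c i * (if unlift ord0 i is Some k then b k j else a j)) *: e j).
    under [RHS]eq_bigr do rewrite big_ord_recl unlift_none scalerDl scaler_suml.
    rewrite big_split/= exchange_big/=; congr (_ + _).
      by rewrite -aE scaler_sumr; apply: eq_bigr => j _; rewrite scalerA.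
    apply: eq_bigr => k _.
    by rewrite -bE scaler_sumr; apply: eq_bigr => j _; rewrite scalerA liftK.
  by clear -cM; apply: big1 => j _; rewrite cM scale0r.
have linc : inc (c ord0 *: x + \sum_i c (lift ord0 i) *: u i) =
    c ord0 *: inc x + \sum_i c (lift ord0 i) *: inc (u i).
  rewrite incl10D incl10Z; congr (_ + _).
  exact: (incl10_comb u (fun k => c (lift ord0 k))).
have {}linc := etrans (esym linc) (etrans (congr1 inc lin) (linear0 inc)).
have cS k : c (lift ord0 k) = 0.
  rewrite -(orthonormal_coef (fun i => c (lift ord0 i)) k ou).
  have := congr1 (fun y => <| y, inc (u k) |>_0) linc.
  by rewrite l2_innerDl l2_innerZl xu mulr0 add0r => ->; exact: l2_inner0l.
have cN : c ord0 != 0 by case: (unliftP ord0 i) ci => [k|] ->//; rewrite cS eqxx.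
have sum0 : \sum_i c (lift ord0 i) *: u i = 0.
  by clear -cS; apply: big1 => k _; rewrite cS scale0r.
have /eqP : c ord0 *: x = 0.
  by move: lin sum0; clear => + sum0; rewrite sum0 addr0.
by rewrite scaler_eq0 (negPf cN) => /eqP.
Qed.

End Orthonormal.

Section EigenvalueBounds.
Variables (R : realType) (h : growth_fun R).
Local Notation H r := (l2 h r).
Local Notation "<| x , y |>_ r" := (@l2_inner R h r x y)
  (at level 0, x, y at level 99, r at level 0).
Local Notation inc := (@incl10 R h).

Variable A : {linear H 1 -> H 0}.
Variables (I : finType) (u : I -> H 1) (lam : I -> R).
Hypothesis ou : orthonormal_family u.
Hypothesis Au : forall i, A (u i) = lam i *: inc (u i).

(** Some nonzero combination x of the eigenvectors vanishes on the first n coordinates, and there c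
    h(n) |x|_0^2 <= c |x|_1^2 <= |A x|_0^2 <= t |x|_0^2. *)
Lemma eigen_weight_le n c t : (n < #|I|)%N -> 0 <= c ->
  (forall x, c * <| x, x |>_1 <= <| A x, A x |>_0) ->
  (forall i, lam i ^+ 2 <= t) -> c * h n <= t.
Proof.
move=> nI c0 cA lt.
have [|a [[i ai] aM]] := @nontrivial_combination _ I 'I_n (fun i j => u i j).
  by rewrite card_ord.
pose x := \sum_i a i *: u i.
have x0 j : (j < n)%N -> x j = 0.
  by move=> jn; rewrite l2_val_sum -[RHS](aM (Ordinal jn)).
have ix : inc x = \sum_i a i *: inc (u i).
  exact: incl10_comb.
have Ax : A x = \sum_i (a i * lam i) *: inc (u i).
  by rewrite linear_sum; apply: eq_bigr => j _; rewrite linearZ/= Au scalerA.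
have xx : <| inc x, inc x |>_0 = \sum_i a i ^+ 2 by rewrite ix orthonormal_inner.
have xx0 : 0 < <| inc x, inc x |>_0.
  rewrite xx (bigD1 i)//= ltr_pwDl//.
    by rewrite lt_neqAle sqr_ge0 andbT eq_sym sqrf_eq0.
  by apply: sumr_ge0 => j _; exact: sqr_ge0.
rewrite -(ler_pM2r xx0) -mulrA.
apply: le_trans (_ : c * <| x, x |>_1 <= _); first by rewrite ler_wpM2l// l2_tail.
apply: le_trans (cA x) _; rewrite Ax orthonormal_inner// xx mulr_sumr.
apply: ler_sum => j _.
by rewrite -expr2 exprMn mulrC ler_wpM2r ?sqr_ge0.
Qed.

Variable S : {linear H 0 -> H 1}.
Hypothesis A_sym : forall x y, <| A x, inc y |>_0 = <| inc x, A y |>_0.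
Hypothesis S_bnd : bounded_op S.
Hypothesis SK : cancel A S.
Hypothesis AK : cancel S A.

Lemma symmetric_inverse x y : <| inc (S x), y |>_0 = <| x, inc (S y) |>_0.
Proof. by have := A_sym (S x) (S y); rewrite (AK x) (AK y). Qed.

Lemma inverse_eigenvector : (forall i, lam i != 0) ->
  forall i, inc (S (inc (u i))) = (lam i)^-1 *: inc (u i).
Proof.
move=> lam0 i; rewrite (cancel_eigenvector SK (lam0 i) (Au i)).
exact: incl10Z.
Qed.

(** A nonzero x supported on the first n + 1 coordinates is orthogonal to all u i, hence so is z = A
    x by symmetry. Since |A^-1 z|_0^2 = |x|_0^2 is at least |z|_0^2 / (C h(n)), the maximum
    principle for A^-1 on the orthogonal complement produces an eigenvalue of A^-1 at least that
    large in square. *)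
Lemma eigenvector_orthogonal n C : (#|I| <= n)%N -> (forall i, lam i != 0) ->
  0 < C -> (forall x, <| A x, A x |>_0 <= C * <| x, x |>_1) ->
  exists (w : H 1) (mu : R), [/\ w != 0, mu != 0, mu ^+ 2 <= C * h n,
    A w = mu *: inc w & forall i, <| inc w, inc (u i) |>_0 = 0].
Proof.
move=> In lam0 C0 AC.
have [|a [[k ak] aM]] := @nontrivial_combination _ 'I_n.+1 I (fun k i => u i k).
  by rewrite card_ord.
pose x := head_l2 h 1 (fun k => a (inord k)) n.+1.
have xE (i : 'I_n.+1) : x i = a i by rewrite head_l2E ltn_ord inord_val.
have ix : inc x = \sum_(i < n.+1) a i *: dirac_l2 h 0 i.
  apply: val_inj; apply/funext => i; rewrite -[LHS]/(x i).
  rewrite -[RHS]/((\sum_(i < n.+1) a i *: dirac_l2 h 0 i : H 0) i).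
  rewrite head_l2E l2_val_sum; case: ltnP => [iN|ni].
    rewrite (bigD1 (Ordinal iN))//= [X in _ = _ + X]big1 ?addr0.
      rewrite -[RHS]/(a (Ordinal iN) * (i == i)%:R) eqxx mulr1; congr a.
      by apply: val_inj; rewrite /= inordK.
    move=> j; rewrite -val_eqE /= eq_sym => /negPf ij.
    by rewrite -[LHS]/(a j * (i == j)%:R) ij mulr0.
  rewrite big1// => j _; rewrite -[LHS]/(a j * (i == j)%:R).
  by rewrite (gtn_eqF (leq_trans (ltn_ord j) ni)) mulr0.
have xu i : <| inc x, inc (u i) |>_0 = 0.
  rewrite ix l2_inner_suml -[RHS](aM i); apply: eq_bigr => j _.
  by rewrite l2_innerZl l2_innerC l2_inner_dirac0.
have x0 : x != 0.
  by apply: contra_neq ak => x0; rewrite -xE x0.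
have Chn : 0 < C * h n by rewrite mulr_gt0// growth_gt0.
have [|||||w [sg [w0 wu Kw sgm]]] := @symmetric_compact_eigen R h S symmetric_inverse
  S_bnd I (fun i => inc (u i)) (fun i => (lam i)^-1) (A x) (C * h n)^-1.
- exact: inverse_eigenvector lam0.
- by move=> i; rewrite A_sym Au l2_innerZr xu mulr0.
- by apply: contra_neq x0; exact: cancel_linear_ker0 SK _.
- by rewrite invr_gt0.
- have xh : <| x, x |>_1 <= h n * <| inc x, inc x |>_0.
    by apply: l2_head_le => i ni; rewrite head_l2E ltnS leqNgt ni.
  apply: le_trans (_ : <| inc x, inc x |>_0 <= _); last first.
    apply: eq_ler.
    exact: esym (congr1 (fun z => <| inc z, inc z |>_0) (SK x)).
  move: (AC x) xh Chn C0.
  move: <| A x, A x |>_0 <| x, x |>_1 <| inc x, inc x |>_0 (h n).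
  move=> p q s t pq qs Ct C0'.
  by rewrite (ler_pdivrMl _ _ Ct); apply: le_trans pq _; rewrite -mulrA (ler_pM2l C0').
have sg0 : sg != 0 by exact: inv_le_sqr_neq0 sgm.
(* The eigenvector w of the inverse lies in H 0; S w is a multiple of it that lies in H 1. *)
exists (S w), sg^-1; split.
- by apply: contra_neq w0; exact: cancel_linear_ker0 AK _.
- by rewrite invr_eq0.
- exact: inv_le_sqr.
- exact: etrans (AK w) (scaler_swap sg0 Kw).
- move=> i; apply: etrans (congr1 (fun z => <| z, inc (u i) |>_0) Kw) _.
  by rewrite l2_innerZl wu mulr0.
Qed.

End EigenvalueBounds.

Section EigenvalueListing.
Variables (R : realType) (h : growth_fun R).
Local Notation H r := (l2 h r).
Local Notation "<| x , y |>_ r" := (@l2_inner R h r x y)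
  (at level 0, x, y at level 99, r at level 0).
Local Notation inc := (@incl10 R h).

(** Each fibre of f over mu is in bijection with an orthonormal basis of E mu, and v glues these
    bases. Orthogonality is claimed only inside a fibre; across fibres it needs the symmetry of the
    operator. *)
Lemma listing_orthonormal (E : R -> set (H 1)) (f : growth_fun R) :
  lists_with_mult E f -> exists v : nat -> H 1,
  [/\ forall n, E (f n) (v n),
      forall i j, f i = f j -> <| inc (v i), inc (v j) |>_0 = (i == j)%:R &
      forall mu x, 0 < mu -> E mu x ->
        (forall n, f n = mu -> <| inc x, inc (v n) |>_0 = 0) -> x = 0].
Proof.
move=> Ef.
have /choice[w wP] : forall mu, exists w : nat -> H 1, 0 < mu ->
   [/\ forall n, f n = mu -> E mu (w n),
       forall i j, f i = mu -> f j = mu ->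
         <| inc (w i), inc (w j) |>_0 = (i == j)%:R &
       forall x, E mu x ->
        (forall n, f n = mu -> <| inc x, inc (w n) |>_0 = 0) -> x = 0].
  move=> mu; have [mu0|_] := ltP 0 mu; last by exists (fun=> 0).
  have [m [dE /card_set_bijP[phi [phiI phiinj phisurj]]]] := Ef _ mu0.
  have [u [Eu ou umax]] := has_dim_orthonormal dE.
  have philt n : f n = mu -> (phi n < m)%N by move=> fn; exact: phiI.
  (* Extending the basis to all of [nat] avoids carrying bound proofs; m = 0 is separate because
     [inord] needs a nonempty ordinal type. *)
  have [u' u'E] : exists u' : nat -> H 1, forall k : 'I_m, u' k = u k.
    case: m u {dE phiI phiinj phisurj Eu ou umax philt} => [|m] u.
      by exists (fun=> 0) => -[].
    by exists (fun k => u (inord k)) => k; rewrite inord_val.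
  have uphi n (fn : f n = mu) : u' (phi n) = u (Ordinal (philt n fn)).
    exact: (u'E (Ordinal (philt n fn))).
  exists (u' \o phi) => _; split => /=.
  - by move=> n fn; rewrite (uphi n fn).
  - move=> i j fi fj; rewrite (uphi i fi) (uphi j fj).
    rewrite ou -val_eqE /=; congr (_%:R); congr nat_of_bool.
    by apply/eqP/eqP => [|->//]; apply: phiinj; rewrite inE.
  - move=> x Ex xw; apply: umax => // k.
    have [n fn nk] := phisurj k (ltn_ord k).
    by rewrite -u'E -nk; exact: xw.
exists (fun n => w (f n) n); split.
- by move=> n; have [+ _ _] := wP _ (growth_gt0 f n); exact.
- by move=> i j fij; have [_ + _] := wP _ (growth_gt0 f i); rewrite -fij; exact.
- move=> mu x mu0 Ex xw; have [_ _ +] := wP _ mu0; apply => // n fn.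
  by have := xw n fn; rewrite fn.
Qed.

Variable A : {linear H 1 -> H 0}.
Hypothesis A_sym : forall x y, <| A x, inc y |>_0 = <| inc x, A y |>_0.

Lemma symmetric_eigen_orth x y l m : A x = l *: inc x -> A y = m *: inc y ->
  l != m -> <| inc x, inc y |>_0 = 0.
Proof.
move=> Ax Ay lm; have := A_sym x y; rewrite Ax Ay l2_innerZl l2_innerZr.
by move=> /eqP; rewrite -subr_eq0 -mulrBl mulf_eq0 subr_eq0 (negPf lm) => /eqP.
Qed.

(** The last clause is completeness of the joint list. It compares squares because the counting that
    uses it cuts both lists at a bound on squared eigenvalues. *)
Lemma eigen_system (f g : growth_fun R) :
  is_neg_growth A f -> is_pos_growth A g ->
  let ev (i : nat + nat) := match i with inl n => - f n | inr n => g n end in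
  exists v : nat + nat -> H 1,
  [/\ forall i, A (v i) = ev i *: inc (v i),
      orthonormal_family v &
      forall mu x, mu != 0 -> A x = mu *: inc x ->
        (forall i, ev i ^+ 2 = mu ^+ 2 -> <| inc x, inc (v i) |>_0 = 0) ->
        x = 0].
Proof.
move=> /listing_orthonormal[vf [Ef of_ mf]] /listing_orthonormal[vg [Eg og mg]] ev.
pose v i := match i with inl n => vf n | inr n => vg n end.
have Av i : A (v i) = ev i *: inc (v i).
  by case: i => n; [exact: Ef|exact: Eg].
exists v; split; first exact: Av.
- move=> i j; have [eij|nij] := eqVneq (ev i) (ev j); last first.
    rewrite (symmetric_eigen_orth (Av i) (Av j) nij).
    by case: eqP => // ij; move: nij; rewrite ij eqxx.
  move: i j eij => [] i [] j /= eij.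
  + by rewrite of_//; apply: oppr_inj.
  + by exfalso; have := growth_gt0 f i; have := growth_gt0 g j; lra.
  + by exfalso; have := growth_gt0 f j; have := growth_gt0 g i; lra.
  + exact: og.
- move=> mu x mu0 Ax xv.
  have [mu1|mu1] : mu < 0 \/ 0 < mu by apply/orP; rewrite -neq_lt.
  + have Ex : Defs.eigenspace A (- - mu) x by rewrite opprK.
    apply: (mf _ _ _ Ex); first by rewrite oppr_gt0.
    move=> n fn; apply: (xv (inl n)); rewrite /= fn opprK; reflexivity.
  + apply: (mg _ _ mu1 Ax) => n fn.
    apply: (xv (inr n)); rewrite /= fn; reflexivity.
Qed.

End EigenvalueListing.

Section WeylBounds.
Variables (R : realType) (h : growth_fun R).
Local Notation H r := (l2 h r).
Local Notation "<| x , y |>_ r" := (@l2_inner R h r x y)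
  (at level 0, x, y at level 99, r at level 0).
Local Notation inc := (@incl10 R h).

Lemma bounded_op_sqr (f g : growth_fun R) (r s : R) (T : l2 f r -> l2 g s) :
  bounded_op T -> exists2 C, 0 < C &
    forall x, l2_inner (T x) (T x) <= C * l2_inner x x.
Proof.
move=> [D TD]; exists (D ^+ 2 + 1); first by rewrite ltr_wpDl ?sqr_ge0.
move=> x; rewrite -!sqr_l2_norm mulrDl mul1r ler_wpDr ?sqr_ge0//.
by rewrite -exprMn ler_pXn2r ?nnegrE// (le_trans _ (TD x)).
Qed.

Lemma inverse_bound_sqr (f g : growth_fun R) (r s : R)
    (T : l2 f r -> l2 g s) (S : l2 g s -> l2 f r) :
  bounded_op S -> cancel T S -> exists2 c, 0 < c &
    forall x, c * l2_inner x x <= l2_inner (T x) (T x).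
Proof.
move=> /bounded_op_sqr[C C0 SC] TS; exists C^-1; first by rewrite invr_gt0.
by move=> x; rewrite ler_pdivrMl//; have := SC (T x); rewrite TS.
Qed.

Lemma growth_sqr_gt (f : growth_fun R) (M : R) : exists n, M < f n ^+ 2.
Proof.
have [n nM] := growth_unbounded f (`|M| + 1); exists n.
have fn := growth_gt0 f n; have := normr_ge0 M; have := ler_norm M; nra.
Qed.

Lemma growth_initial (f : growth_fun R) (M : R) : exists p,
  (forall i, (i < p)%N -> f i ^+ 2 <= M) /\
  (forall i, f i ^+ 2 <= M -> (i < p)%N).
Proof.
case: (ex_minnP (growth_sqr_gt f M)) => p pM pmin; exists p; split => i.
  by move=> ip; rewrite leNgt; apply/negP => /pmin; rewrite leqNgt ip.
move=> iM; rewrite ltnNge; apply/negP => pi.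
move: pM; rewrite ltNge => /negP; apply; apply: le_trans iM.
by rewrite ler_pXn2r ?nnegrE ?growth_ge0// growth_nd.
Qed.

(* [weyl_upper] and [weyl_lower] say that the square of the n-th term of the  *)
(* nondecreasing merge of f and g is at least c * h n and at most C * h n.    *)
Definition weyl_upper (f g : growth_fun R) (c : R) := forall n p q t,
  (forall i, (i < p)%N -> f i ^+ 2 <= t) ->
  (forall i, (i < q)%N -> g i ^+ 2 <= t) -> (n < p + q)%N -> c * h n <= t.

Definition weyl_lower (f g : growth_fun R) (C : R) := forall n, exists p q,
  [/\ (n < p + q)%N, forall i, (i < p)%N -> f i ^+ 2 <= C * h n &
      forall i, (i < q)%N -> g i ^+ 2 <= C * h n].

Lemma weyl_bounds (A : {linear H 1 -> H 0}) (f g : growth_fun R) :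
  (forall x y, <| A x, inc y |>_0 = <| inc x, A y |>_0) -> isomorphism A ->
  is_neg_growth A f -> is_pos_growth A g ->
  (exists2 c, 0 < c & weyl_upper f g c) /\ (exists2 C, 0 < C & weyl_lower f g C).
Proof.
move=> A_sym [A_bnd [S [S_bnd SK AK]]] Af Ag.
have [C C0 AC] := bounded_op_sqr A_bnd.
have [c c0 Ac] := inverse_bound_sqr S_bnd SK.
have [v [Av ov vmax]] := eigen_system A_sym Af Ag.
pose emb p q (i : 'I_p + 'I_q) : nat + nat :=
  match i with inl k => inl (k : nat) | inr k => inr (k : nat) end.
have emb_inj p q : injective (@emb p q).
  by move=> [] i [] j //= [] /val_inj ->.
have oemb p q : orthonormal_family (v \o @emb p q).
  by move=> i j /=; rewrite ov (inj_eq (@emb_inj p q)).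
pose ev (i : nat + nat) := match i with inl n => - f n | inr n => g n end.
have Avemb p q i :
    A ((v \o @emb p q) i) = (ev \o @emb p q) i *: inc ((v \o @emb p q) i).
  exact: (Av (@emb p q i)).
split.
  exists c => // n p q t fp gq npq.
  apply: (@eigen_weight_le R h A _ _ _ (oemb p q) (Avemb p q) n c t _ (ltW c0) Ac).
    by rewrite card_sum !card_ord.
  by case=> i /=; [rewrite sqrrN; exact: fp|exact: gq].
exists C => // n.
have [p [pP pM]] := growth_initial f (C * h n).
have [q [qP qM]] := growth_initial g (C * h n).
(* p and q count all terms with square at most C h(n). If p + q <= n, there would be an eigenvector
   below this threshold orthogonal to every listed one below it, against completeness. *)
exists p, q; split => //; rewrite ltnNge; apply/negP => pqn.
have [||w [mu [w0 mu0 muC Aw wu]]] :=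
    @eigenvector_orthogonal R h A _ _ _ (Avemb p q) S A_sym S_bnd SK AK n C _ _ C0 AC.
- by rewrite card_sum !card_ord.
- by case=> i /=; rewrite ?oppr_eq0 gt_eqF ?growth_gt0.
move/eqP: w0; apply; apply: (vmax mu) => //.
by case=> i /= fi;
  [have ip : (i < p)%N by apply: pM; rewrite -sqrrN fi
  |have ip : (i < q)%N by apply: qM; rewrite fi];
  [exact: (wu (inl (Ordinal ip)))|exact: (wu (inr (Ordinal ip)))].
Qed.

End WeylBounds.

(** * Regular values of symmetric Fredholm operators *)

Lemma linear_bijective_inverse (R : pzRingType) (V W : lmodType R) (B : V -> W) :
  linear B -> injective B -> (forall y, exists x, B x = y) ->
  exists S : {linear W -> V}, cancel B S /\ cancel S B.
Proof.
move=> Blin Binj /choice[S BS].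
have Slin : linear S by move=> a x y; apply: Binj; rewrite Blin !BS.
exists (HB.pack_for {linear W -> V} S (GRing.isLinear.Build _ _ _ _ S Slin)).
by split => // x; apply: Binj; rewrite BS.
Qed.

Lemma half_lipschitz_fixpoint (R : realType) (X : completeNormedModType R)
    (F : X -> X) :
  (forall x y, `|F x - F y| <= 2^-1 * `|x - y|) -> exists p, p = F p.
Proof.
move=> Flip.
pose G := HB.pack_for {fun [set: X] >-> [set: X]} F
  (isFun.Build _ _ [set: X] [set: X] F (fun _ _ => I)).
have [||p _ pF] := @banach_fixed_point R X setT G _ closedT; last by exists p.
  have h0 : 0 <= 2^-1 :> R by rewrite invr_ge0.
  exists (NngNum h0); split; first by rewrite /= invf_lt1// ltr1n.
  by move=> [x y] _ /=; exact: Flip.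
by exists 0.
Qed.

Lemma l2_norm_le_sqrt (R : realType) (f g : growth_fun R) (r s c : R)
    (x : l2 f r) (y : l2 g s) :
  0 <= c -> l2_inner x x <= c * l2_inner y y -> `|x| <= Num.sqrt c * `|y|.
Proof.
move=> c0; rewrite -!sqr_l2_norm -[X in X * _](sqr_sqrtr c0) -exprMn.
by rewrite ler_pXn2r ?nnegrE ?mulr_ge0 ?sqrtr_ge0.
Qed.

Section Resolvent.
Variables (R : realType) (h : growth_fun R).
Local Notation H r := (l2 h r).
Local Notation "<| x , y |>_ r" := (@l2_inner R h r x y)
  (at level 0, x, y at level 99, r at level 0).
Local Notation inc := (@incl10 R h).

(** The inverse inherits the symmetry, so Hellinger-Toeplitz gives its boundedness in place of the
    open mapping theorem. *)
Lemma symmetric_bijective_isomorphism (A : {linear H 1 -> H 0}) :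
  (forall x y, <| A x, inc y |>_0 = <| inc x, A y |>_0) -> bounded_op A ->
  injective A -> (forall y, exists x, A x = y) -> isomorphism A.
Proof.
move=> A_sym A_bnd Ainj Asurj; split; first exact: A_bnd.
have [S [SK AK]] := linear_bijective_inverse (linearP A) Ainj Asurj.
exists S; split; [|exact: SK|exact: AK]; apply: symmetric_bounded.
exact: symmetric_inverse A_sym AK.
Qed.

Lemma shift_op_bounded (A : {linear H 1 -> H 0}) l :
  bounded_op A -> bounded_op (shift_op A l).
Proof.
move=> /bounded_op_sqr[C C0 AC].
exists (Num.sqrt (2 * C + 2 * l ^+ 2 * (h 0%N)^-1)) => x.
have h0 : 0 <= (h 0%N)^-1 by rewrite invr_ge0 growth_ge0.
have C20 : 0 <= 2 * C + 2 * l ^+ 2 * (h 0%N)^-1.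
  by rewrite -mulrA -mulrDr pmulr_rge0// addr_ge0 ?(ltW C0)// mulr_ge0 ?sqr_ge0.
apply: l2_norm_le_sqrt C20 _.
change (<| A x - l *: inc x, A x - l *: inc x |>_0 <=
  (2 * C + 2 * l ^+ 2 * (h 0%N)^-1) * <| x, x |>_1).
apply: le_trans (l2_inner_add_le _ _) _.
have : <| inc x, inc x |>_0 <= (h 0%N)^-1 * <| x, x |>_1.
  by apply: le_trans (l2_tail_le x 0) _; rewrite big_ord0 add0r.
have := AC x; rewrite l2_innerNl l2_innerC l2_innerNl opprK l2_innerZl l2_innerZr.
move: <| A x, A x |>_0 <| x, x |>_1 <| inc x, inc x |>_0 => p q s pq sq.
have : l ^+ 2 * s <= l ^+ 2 * ((h 0%N)^-1 * q) by rewrite ler_wpM2l ?sqr_ge0.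
by rewrite mulrDl -!mulrA !(mulrA l l) -expr2; lra.
Qed.

Lemma shift_op_symmetric (A : {linear H 1 -> H 0}) l :
  (forall x y, <| A x, inc y |>_0 = <| inc x, A y |>_0) ->
  forall x y, <| shift_op A l x, inc y |>_0 = <| inc x, shift_op A l y |>_0.
Proof.
move=> A_sym x y; rewrite -[shift_op A l x]/(A x - l *: inc x).
rewrite -[shift_op A l y]/(A y - l *: inc y).
by rewrite l2_innerBl l2_innerBr A_sym l2_innerZl l2_innerZr.
Qed.

Variable A : {linear H 1 -> H 0}.
Hypothesis A_sym : forall x y, <| A x, inc y |>_0 = <| inc x, A y |>_0.
Hypothesis A_fred : fredholm_of_index A 0.

(** Symmetry puts the range inside the orthogonal complement of the kernel; index zero makes them
    equal. Indeed the range has codimension m, so y and the m kernel vectors are dependent modulo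
    the range, and pairing with the kernel vectors leaves only the multiple of y. *)
Lemma fredholm_kernel : exists m (k : 'I_m -> H 1),
  [/\ forall i, A (k i) = 0, orthonormal_family k,
      forall x, A x = 0 -> (forall i, <| inc x, inc (k i) |>_0 = 0) -> x = 0 &
      forall y, (forall i, <| y, inc (k i) |>_0 = 0) -> exists x, A x = y].
Proof.
have [_ _ [m [n [dimK codimR]]]] := A_fred.
move=> /eqP; rewrite eq_sym subr_eq0 => /eqP -[mn]; move: codimR; rewrite -mn.
move=> {n mn} [e [_ eR]].
have [k [kK ok kmax]] := has_dim_orthonormal dimK.
exists m, k; split => // y yk.
pose v (i : 'I_m.+1) := if unlift ord0 i is Some j then inc (k j) else y.
have /choice[M vM] : forall i, exists c : 'I_m -> R,
    range A (v i - \sum_j c j *: e j) by move=> i; exact: eR.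
have /choice[z zM] : forall i, exists z, A z = v i - \sum_j M i j *: e j.
  by move=> i; have [z _ zi] := vM i; exists z.
have [|c [[i ci] cM]] := @nontrivial_combination _ 'I_m.+1 'I_m M.
  by rewrite !card_ord.
have Az : A (\sum_i c i *: z i) = \sum_i c i *: v i.
  rewrite linear_sum.
  transitivity (\sum_i (c i *: v i - \sum_j (c i * M i j) *: e j)).
    apply: eq_bigr => l _; rewrite linearZ/= zM scalerBr; congr (_ - _).
    by rewrite scaler_sumr; apply: eq_bigr => j _; rewrite scalerA.
  rewrite sumrB exchange_big/= [X in _ - X]big1 ?subr0// => j _.
  by rewrite -scaler_suml cM scale0r.
have AZ : A (\sum_i c i *: z i) = c ord0 *: y + \sum_j c (lift ord0 j) *: inc (k j).
  rewrite Az big_ord_recl /v unlift_none; congr (_ + _).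
  by apply: eq_bigr => j _; rewrite liftK.
have cS j : c (lift ord0 j) = 0.
  have := A_sym (\sum_i c i *: z i) (k j).
  rewrite (kK j) l2_inner0r AZ l2_innerDl l2_innerZl yk mulr0 add0r.
  by rewrite (orthonormal_coef (fun j => c (lift ord0 j)) j ok).
have c0 : c ord0 != 0 by case: (unliftP ord0 i) ci => [j|] ->//; rewrite cS eqxx.
have sum0 : \sum_j c (lift ord0 j) *: inc (k j) = 0.
  by clear -cS; apply: big1 => j _; rewrite cS scale0r.
exists ((c ord0)^-1 *: \sum_i c i *: z i).
have AZ' : A (\sum_i c i *: z i) = c ord0 *: y.
  by rewrite AZ; move: sum0; clear => ->; rewrite addr0.
by apply: esym; rewrite linearZ/=; exact: scaler_swap c0 AZ'.
Qed.

(* With P the H 0-orthogonal projection onto ker A, B = A + P has a bounded   *)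
(* inverse S.  For 0 < l small, A - l is injective by contraction, and        *)
(* (A - l) x = y is solved on ker A by - P y / l and on its orthogonal by the *)
(* fixed point of z |-> S (y - P y) + l S z.                                  *)
Lemma fredholm_not_spec : exists l, ~ spec A l.
Proof.
have [m [k [kK ok kmax ksurj]]] := fredholm_kernel.
pose P (y : H 0) := \sum_i <| y, inc (k i) |>_0 *: k i.
pose Q (y : H 0) : H 0 := \sum_i <| y, inc (k i) |>_0 *: inc (k i).
have incP y : inc (P y) = Q y.
  exact: (incl10_comb k (fun i => <| y, inc (k i) |>_0)).
have QL a x y : Q (a *: x + y) = a *: Q x + Q y.
  rewrite /Q scaler_sumr -big_split; apply: eq_bigr => i _ /=.
  by rewrite l2_innerDl l2_innerZl scalerDl scalerA.
have Qk y i : <| Q y, inc (k i) |>_0 = <| y, inc (k i) |>_0.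
  exact: (orthonormal_coef (fun i => <| y, inc (k i) |>_0) i ok).
have Ak x i : <| A x, inc (k i) |>_0 = 0 by rewrite A_sym kK l2_inner0r.
have AP y : A (P y) = 0.
  rewrite linear_sum; clear -kK; apply: big1 => i _.
  by rewrite linearZ/= kK scaler0.
have Q0 y : (forall i, <| y, inc (k i) |>_0 = 0) -> Q y = 0.
  by clear => yk; apply: big1 => i _; rewrite yk scale0r.
pose B (x : H 1) := A x + Q (inc x).
have Blin : linear B.
  move=> a x y; rewrite /B linearP incl10D incl10Z QL scalerDr.
  by rewrite -!addrA; congr (_ + _); rewrite addrCA.
have B_sym x y : <| B x, inc y |>_0 = <| inc x, B y |>_0.
  rewrite /B l2_innerDl l2_innerDr A_sym; congr (_ + _).
  rewrite l2_inner_suml l2_inner_sumr; apply: eq_bigr => i _.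
  by rewrite l2_innerZl l2_innerZr mulrC (l2_innerC (inc y)).
have Bk x i : <| B x, inc (k i) |>_0 = <| inc x, inc (k i) |>_0.
  by rewrite l2_innerDl Ak Qk add0r.
have QQ y : Q (Q y) = Q y.
  by apply: eq_bigr => i _; rewrite Qk.
have BP y : B (P y) = Q y by rewrite /B AP incP QQ add0r.
have Bker x : B x = 0 -> x = 0.
  move=> Bx; have xk i : <| inc x, inc (k i) |>_0 = 0.
    by rewrite -Bk Bx l2_inner0l.
  apply: (kmax _ _ xk); apply: etrans Bx.
  by rewrite /B (Q0 _ xk) addr0.
have Binj : injective B.
  move=> x y Bxy; apply/eqP; rewrite -subr_eq0; apply/eqP; apply: Bker.
  rewrite -scaleN1r addrC Blin Bxy scaleN1r; exact: addNr.
have Bsurj y : exists x, B x = y.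
  have [|x0 Ax0] := ksurj (y - Q y).
    by move=> i; rewrite l2_innerBl Qk subrr.
  (* A x0 = y - Q y, and B (P v) = Q v: the P terms cancel Q (inc x0) and restore Q y. *)
  exists ((-1) *: P (inc x0) + (1 *: x0 + P y)).
  rewrite !Blin !BP scaleN1r scale1r /B Ax0.
  by move: (Q (inc x0)) (Q y) => q r; rewrite addrAC subrK addrC addrK.
have [S [SB BS]] := linear_bijective_inverse Blin Binj Bsurj.
have S_sym x y : <| inc (S x), y |>_0 = <| x, inc (S y) |>_0.
  by have := B_sym (S x) (S y); rewrite (BS x) (BS y).
have [C C0 SC] := bounded_op_sqr (symmetric_bounded S_sym).
pose K y : H 0 := inc (S y).
have [D D0 KD] : exists2 D, 0 < D & forall y, `|K y| <= D * `|y|.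
  have CK y : <| K y, K y |>_0 <= (h 0%N)^-1 * C * <| y, y |>_0.
    apply: le_trans (l2_tail_le (S y) 0) _; rewrite big_ord0 add0r -mulrA.
    by rewrite ler_pM2l ?invr_gt0 ?growth_gt0.
  have hC : 0 < (h 0%N)^-1 * C by rewrite mulr_gt0 ?invr_gt0 ?growth_gt0.
  exists (Num.sqrt ((h 0%N)^-1 * C)); first by rewrite sqrtr_gt0.
  by move=> y; apply: l2_norm_le_sqrt (ltW hC) (CK y).
have KL a x y : K (a *: x + y) = a *: K x + K y.
  by rewrite /K linearP incl10D incl10Z.
(* This makes l K a contraction of factor 1/2 and also gives l < 1. *)
pose l := (2 * (D + 1))^-1.
have l0 : 0 < l by rewrite invr_gt0 mulr_gt0// addr_gt0.
have lD : l * D <= 2^-1.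
  by rewrite /l invfM -mulrA ger_pMr ?invr_gt0// ler_pdivrMl ?addr_gt0//; lra.
have l1 : 1 - l != 0.
  rewrite subr_eq0 eq_sym lt_eqF// /l invf_lt1 ?mulr_gt0 ?addr_gt0//; lra.
have Kl y : `|l *: K y| <= 2^-1 * `|y|.
  rewrite normrZ (gtr0_norm l0); apply: le_trans (_ : l * (D * `|y|) <= _).
    by rewrite ler_pM2l.
  by rewrite mulrA ler_wpM2r.
have KZ a x : K (a *: x) = a *: K x.
  by rewrite /K linearZ; exact: incl10Z.
have KB x y : K (x - y) = K x - K y.
  by rewrite -scaleN1r addrC KL scaleN1r addrC.
have orth_of_eigen x : A x = l *: inc x -> x = 0.
  move=> Ax; have xk i : <| inc x, inc (k i) |>_0 = 0.
    have := Ak x i; rewrite Ax l2_innerZl => /eqP.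
    by rewrite mulf_eq0 (gt_eqF l0) => /eqP.
  have Bx : B x = l *: inc x by rewrite /B (Q0 _ xk) addr0.
  have ix : inc x = l *: K (inc x).
    by rewrite -KZ -Bx /K; exact: esym (congr1 inc (SB x)).
  have nx : `|inc x| <= 2^-1 * `|inc x| by rewrite {1}ix; exact: Kl.
  apply: incl10_inj; apply: etrans (esym (linear0 inc)).
  by apply/eqP; rewrite -normr_le0; lra.
have solve y : exists x, A x - l *: inc x = y.
  have [z zE] : exists z : H 0, z = K (y - Q y) + l *: K z.
    apply: half_lipschitz_fixpoint => a b.
    by rewrite opprD addrACA subrr add0r -scalerBr -KB.
  pose w := l *: z + (y - Q y).
  have zKw : z = inc (S w) by rewrite {1}zE -[inc _]/(K w) /w KL addrC.
  have Bw : A (S w) + Q z = l *: z + (y - Q y).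
    by have := BS w; rewrite /B -zKw.
  (* Pairing [Bw] with a kernel vector gives (1 - l) times this inner product equal to 0. *)
  have zk i : <| z, inc (k i) |>_0 = 0.
    have := congr1 (fun v => <| v, inc (k i) |>_0) Bw.
    rewrite /= !l2_innerDl Ak Qk l2_innerNl Qk subrr addr0 add0r l2_innerZl.
    move=> /eqP; rewrite -subr_eq0 -{1}[<| z, _ |>_0]mul1r -mulrBl mulf_eq0.
    by rewrite (negPf l1) => /eqP.
  rewrite (Q0 _ zk) addr0 in Bw.
  exists (- l^-1 *: P y + S w).
  rewrite linearP incl10D incl10Z (AP y) incP -zKw Bw scaler0 add0r scalerDr scalerA.
  rewrite mulrN mulfV ?gt_eqF// scaleN1r opprD opprK.
  by move: (l *: z) (Q y) => p q; rewrite [q - p]addrC addrACA subrr add0r subrK.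
exists l => /=; apply; apply: symmetric_bijective_isomorphism.
- exact: (shift_op_symmetric l A_sym).
- by apply: shift_op_bounded; have [] := A_fred.
- apply: raddf_inj => x /eqP; rewrite subr_eq0 => /eqP; exact: orth_of_eigen.
- exact: solve.
Qed.

End Resolvent.

(** * Shift invariance *)

Section GrowthArithmetic.
Variable R : realType.
Implicit Types f g h : growth_fun R.

Lemma same_growth_shiftP f : same_growth f (Defs.shift f) <->
  exists2 c : R, 0 < c & forall n, f n.+1 <= c * f n.
Proof.
split=> [[c c0 cP]|[c c0 cP]].
  exists c => // n; have /andP[+ _] := cP n; rewrite /Defs.shift.
  by rewrite ler_pdivrMl.
have c1 : 0 < c + 1 by rewrite addr_gt0.
exists (c + 1) => // n; rewrite /Defs.shift ler_pdivrMl//.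
have := cP n; have := growth_gt0 f n; have := growth_gt0 f n.+1.
have : f n <= f n.+1 by apply: growth_nd.
by move=> *; apply/andP; split; nra.
Qed.

Lemma same_growth_le f g : same_growth f g -> exists2 c : R, 0 < c &
  forall n, f n <= c * g n /\ g n <= c * f n.
Proof.
move=> [c c0 cP]; exists c => // n; have /andP[gf fg] := cP n; split => //.
by rewrite -ler_pdivrMl.
Qed.

(** Among p + q > n terms with square at most C h(n), lengthening one nonempty list by a term raises
    the bound by a constant factor only, and p + q + 1 > n + 1 terms then bound h(n+1). *)
Lemma weyl_weight_shift h f g c C : 0 < c -> 0 < C ->
  weyl_upper h f g c -> weyl_lower h f g C ->
  same_growth f (Defs.shift f) -> same_growth g (Defs.shift g) ->
  same_growth h (Defs.shift h).
Proof.
move=> c0 C0 up low /same_growth_shiftP[a a0 fa] /same_growth_shiftP[b b0 gb].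
apply/same_growth_shiftP; exists (c^-1 * ((a + b + 1) ^+ 2 * C)).
  by rewrite !mulr_gt0 ?invr_gt0// addr_gt0// addr_gt0.
set k := a + b + 1; have k1 : 1 <= k ^+ 2 by rewrite expr_ge1// /k; lra.
move=> n; rewrite -mulrA ler_pdivlMl// -mulrA.
have [p [q [npq fp gq]]] := low n.
have Ch : 0 <= C * h n by rewrite mulr_ge0 ?growth_ge0// ltW.
have CkC : C * h n <= k ^+ 2 * (C * h n) by rewrite ler_peMl.
have step (e : growth_fun R) d m : 0 < d -> d <= k ->
    (forall i, e i.+1 <= d * e i) -> (forall i, (i < m.+1)%N -> e i ^+ 2 <= C * h n) ->
    forall i, (i < m.+2)%N -> e i ^+ 2 <= k ^+ 2 * (C * h n).
  move=> d0 dk ed em [_|i im]; first by apply: le_trans CkC; exact: em.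
  apply: le_trans (_ : k ^+ 2 * e i ^+ 2 <= _).
    rewrite -exprMn ler_pXn2r ?nnegrE ?mulr_ge0 ?growth_ge0 ?(le_trans (ltW d0))//.
    by apply: le_trans (ed i) _; rewrite ler_wpM2r// growth_ge0.
  by rewrite ler_wpM2l ?sqr_ge0// em.
(* The list to lengthen must be nonempty, since its new term is bounded through the preceding one;
   if f contributes nothing, g does. *)
case: p npq fp => [|p] npq fp.
  case: q npq gq => [//|q] npq gq.
  apply: (up n.+1 0%N q.+2) => //.
  by apply: (step g b) => //; rewrite /k; lra.
apply: (up n.+1 p.+2 q); last by rewrite addSn.
  by apply: (step f a) => //; rewrite /k; lra.
by move=> i iq; apply: le_trans (gq i iq) CkC.
Qed.

(** The first n + 1 terms of both lists bound h(2n+1) by a multiple of f(n)^2. Conversely, among p +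
    q > 2n + 2 terms one list reaches index n + 1, so f(n+1)^2 is at most a multiple of h(2n+2).
    These two values of h are consecutive. *)
Lemma weyl_eigen_shift h f g c C : 0 < c -> 0 < C ->
  weyl_upper h f g c -> weyl_lower h f g C ->
  same_growth f g -> same_growth h (Defs.shift h) -> same_growth f (Defs.shift f).
Proof.
move=> c0 C0 up low /same_growth_le[d d0 dP] /same_growth_shiftP[k k0 hk].
pose M := (d ^+ 2 + 1) ^+ 2 * C * k * c^-1.
have M0 : 0 < M by rewrite !mulr_gt0 ?invr_gt0// ltr_wpDl ?sqr_ge0.
have d1 : 1 <= d ^+ 2 + 1 by rewrite lerDr sqr_ge0.
apply/same_growth_shiftP; exists (M + 1) => [|n]; first by rewrite addr_gt0.
have fM : f n.+1 ^+ 2 <= M * f n ^+ 2.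
  have up_n : c * h (n.+1 + n)%N <= (d ^+ 2 + 1) * f n ^+ 2.
    apply: (up _ n.+1 n.+1); last by rewrite ltn_add2l.
      move=> i; rewrite ltnS => i_n; apply: le_trans (_ : f n ^+ 2 <= _).
        by rewrite ler_pXn2r ?nnegrE ?growth_ge0// growth_nd.
      by rewrite ler_peMl ?sqr_ge0.
    move=> i; rewrite ltnS => i_n; apply: le_trans (_ : (d * f n) ^+ 2 <= _).
      rewrite ler_pXn2r ?nnegrE ?mulr_ge0 ?growth_ge0 ?(ltW d0)//.
      by apply: le_trans (proj2 (dP n)); rewrite growth_nd.
    by rewrite exprMn mulrDl mul1r lerDl sqr_ge0.
  have low_n : f n.+1 ^+ 2 <= (d ^+ 2 + 1) * (C * h (n.+1 + n.+1)%N).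
    have Ch : 0 <= C * h (n.+1 + n.+1)%N by rewrite mulr_ge0 ?growth_ge0// ltW.
    have [p [q [npq fp gq]]] := low (n.+1 + n.+1)%N.
    have [np|pn] := ltnP n.+1 p.
      by apply: le_trans (fp _ np) _; rewrite ler_peMl.
    have nq : (n.+1 < q)%N.
      by rewrite ltnNge; apply: contraL npq => ?; rewrite -leqNgt leq_add.
    apply: le_trans (_ : (d * g n.+1) ^+ 2 <= _).
      rewrite ler_pXn2r ?nnegrE ?mulr_ge0 ?growth_ge0 ?(ltW d0)//.
      exact: (proj1 (dP _)).
    rewrite exprMn; apply: ler_pM; rewrite ?sqr_ge0 ?lerDl//; exact: gq.
  have hh := hk (n.+1 + n)%N; rewrite -addnS in hh.
  apply: le_trans low_n _.
  have -> : M * f n ^+ 2 =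
      (d ^+ 2 + 1) * (C * (k * (c^-1 * ((d ^+ 2 + 1) * f n ^+ 2)))).
    by rewrite /M; ring.
  rewrite ler_pM2l; last by rewrite ltr_wpDl ?sqr_ge0.
  rewrite ler_pM2l//; apply: le_trans hh _.
  by rewrite ler_pM2l// ler_pdivlMl.
rewrite -(@ler_pXn2r _ 2)// ?nnegrE ?mulr_ge0 ?growth_ge0 ?addr_ge0 ?(ltW M0)//.
apply: le_trans fM _; rewrite exprMn ler_wpM2r ?sqr_ge0//.
nra.
Qed.

End GrowthArithmetic.

(** * Diagonal operators *)

Lemma isomorphism_fredholm (R : realType) (V W : normedModType R)
    (T : {linear V -> W}) : isomorphism T -> fredholm_of_index T 0.
Proof.
move=> [T_bnd [S [_ TS ST]]].
have rT : range T = setT by apply/seteqP; split => // y _; exists (S y).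
split => //; first by rewrite rT; exact: closedT.
exists 0%N, 0%N; split=> //.
- exists (fun=> 0); split=> [c _ []//|]; apply/seteqP; split => x /=.
    by move=> /(cancel_linear_ker0 TS) ->; exists (fun=> 0) => //; rewrite big_ord0.
  by move=> [c _ <-]; rewrite big_ord0 linear0.
- by exists (fun=> 0); split=> [c _ []//|w]; exists (fun=> 0); rewrite rT.
Qed.

Section DiagonalOperator.
Variables (R : realType) (h : growth_fun R) (r s : R) (d : nat -> R).
Hypothesis hd : forall n, h n `^ s * d n ^+ 2 = h n `^ r.

(** By [hd], multiplication by d is an isometry. The exponents stay general because the same d acts
    from H 1 to H 0 and from H 2 to H 1, and its inverse is of the same kind with r and s
    exchanged. *)
Lemma diag_weighted (x : nat -> R) :
  weighted_prod h s (fun n => d n * x n) (fun n => d n * x n) =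
  weighted_prod h r x x.
Proof. by apply/funext => n; rewrite /weighted_prod -hd; ring. Qed.

Lemma diag_l2 (x : l2 h r) : (fun n => d n * x n) \in l2_pred h s.
Proof. by rewrite inE /= diag_weighted; have := valP x; rewrite inE. Qed.

Definition diag_fun (x : l2 h r) : l2 h s := L2 (diag_l2 x).

Lemma diag_linear : linear diag_fun.
Proof.
move=> a x y; apply/val_inj/funext => n.
by rewrite [LHS]mulrDr mulrCA.
Qed.

HB.instance Definition _ :=
  GRing.isLinear.Build R (l2 h r) (l2 h s) _ diag_fun diag_linear.

Definition diag_op : {linear l2 h r -> l2 h s} := diag_fun.

Lemma diag_bounded : bounded_op diag_op.
Proof.
exists 1 => x; rewrite mul1r !l2_normE.
by rewrite /l2_inner [weighted_prod _ _ (diag_op x) _]diag_weighted.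
Qed.

End DiagonalOperator.

Section DiagonalIsomorphism.
Variables (R : realType) (h : growth_fun R) (r s : R) (d : nat -> R).
Hypothesis hd : forall n, h n `^ s * d n ^+ 2 = h n `^ r.
Hypothesis d0 : forall n, d n != 0.

Lemma diag_inv_weight n : h n `^ r * (d n)^-1 ^+ 2 = h n `^ s.
Proof. by rewrite -hd -mulrA exprVn mulfV ?mulr1// sqrf_eq0. Qed.

Lemma diagK : cancel (diag_op hd) (diag_op diag_inv_weight).
Proof. by move=> x; apply/val_inj/funext => n; exact: (mulKf (d0 n)). Qed.

Lemma diagVK : cancel (diag_op diag_inv_weight) (diag_op hd).
Proof. by move=> x; apply/val_inj/funext => n; exact: (mulVKf (d0 n)). Qed.

Lemma diag_isomorphism : isomorphism (diag_op hd).
Proof.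
split; first exact: diag_bounded.
exists (diag_op diag_inv_weight).
by split; [exact: diag_bounded|exact: diagK|exact: diagVK].
Qed.

End DiagonalIsomorphism.

Section DiagonalSpectrum.
Variables (R : realType) (h : growth_fun R).
Local Notation H r := (l2 h r).
Local Notation inc := (@incl10 R h).

Lemma has_dim_support (N : set nat) m : N #= `I_m ->
  has_dim [set x : H 1 | forall n, ~ N n -> x n = 0] m.
Proof.
move=> /card_esym/card_set_bijP[psi [psiN psiinj psisurj]].
exists (fun i : 'I_m => dirac_l2 h 1 (psi i)).
have val (c : 'I_m -> R) n :
    (\sum_i c i *: dirac_l2 h 1 (psi i) : H 1) n = \sum_i c i * (n == psi i)%:R.
  by rewrite l2_val_sum.
have valpsi (c : 'I_m -> R) (i : 'I_m) :
    (\sum_i c i *: dirac_l2 h 1 (psi i) : H 1) (psi i) = c i.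
  rewrite val (bigD1 i)//= eqxx mulr1 big1 ?addr0// => j ji.
  case: eqP => [pij|_]; last by rewrite mulr0.
  have /ord_inj ij : i = j :> nat by apply: psiinj; rewrite ?inE/=.
  by rewrite ij eqxx in ji.
split.
  by move=> c c0 i; rewrite -valpsi c0.
apply/seteqP; split => x /=.
  move=> xN; exists (fun i => x (psi i)) => //; apply/val_inj/funext => n.
  have [Nn|Nn] := pselect (N n).
    have [k km <-] := psisurj n Nn.
    exact: (valpsi (fun i => x (psi i)) (Ordinal km)).
  apply: etrans (val _ n) (etrans _ (esym (xN n Nn))).
  apply: big1 => i _; case: eqP => [npi|_]; last by rewrite mulr0.
  by exfalso; apply: Nn; rewrite npi; apply: psiN => /=.
move=> [c _ <-] n Nn; rewrite val big1// => i _.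
case: eqP => [npi|_]; last by rewrite mulr0.
by exfalso; apply: Nn; rewrite npi; apply: psiN => /=.
Qed.

(** The injection e enumerates the indices of positive entries, so it restricts to bijections
    between the fibres of f and those of a, which [lists_with_mult] asks for. *)
Definition lists_positive (a : nat -> R) (f : growth_fun R) :=
  exists e : nat -> nat, [/\ injective e, forall k, a (e k) = f k &
      forall n, 0 < a n -> exists k, e k = n].

Lemma lists_positive_with_mult (a : nat -> R) (f : growth_fun R)
    (E : R -> set (H 1)) :
  (forall mu, 0 < mu -> E mu = [set x : H 1 | forall n, a n <> mu -> x n = 0]) ->
  lists_positive a f -> lists_with_mult E f.
Proof.
move=> EE [e [einj ef esurj]] mu mu0.
have fin : finite_set [set k | f k = mu].
  have [N muN] := growth_unbounded f mu.
  apply: (sub_finite_set _ (finite_II N)) => k /= fk.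
  rewrite ltnNge; apply/negP => Nk; move: muN; rewrite -fk ltNge.
  by rewrite growth_nd.
have [m fm] := (finite_setP _).1 fin.
exists m; split=> //; rewrite EE//; apply: has_dim_support.
apply: card_eq_trans fm; apply: card_esym; apply/card_set_bijP.
exists e; split.
- by move=> k /= <-.
- by move=> i j _ _; exact: einj.
- move=> n /= an; have [|k ek] := esurj n; first by rewrite an.
  by exists k => //=; rewrite -ef ek.
Qed.

Lemma finite_set_bounded (A : set R) :
  finite_set A -> exists M, forall x, A x -> x <= M.
Proof.
move=> /finite_seqP[s ->]; exists (\sum_(x <- s) `|x|) => x /= xs.
rewrite (big_rem x)//=; apply: ler_wpDr; last exact: ler_norm.
by apply: sumr_ge0.
Qed.

End DiagonalSpectrum.

Section ShiftedListing.
Variable R : realType.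
Implicit Types F G f : growth_fun R.

Lemma same_growth_le2 f F (c1 c2 : R) : 0 < c1 -> 0 < c2 ->
  (forall n, f n <= c1 * F n) -> (forall n, F n <= c2 * f n) -> same_growth f F.
Proof.
move=> c10 c20 fF Ff; have c120 : 0 < c1 + c2 by rewrite addr_gt0.
exists (c1 + c2) => // n; have f0 := growth_gt0 f n; have F0 := growth_gt0 F n.
have fFn := fF n; have Ffn := Ff n.
by rewrite ler_pdivrMl//; apply/andP; split; nra.
Qed.

Lemma same_growth_addn F b : same_growth F (Defs.shift F) ->
  exists2 c : R, 0 < c & forall n, F (n + b)%N <= c * F n.
Proof.
move=> /same_growth_shiftP[k k0 Fk]; exists (k ^+ b); first exact: exprn_gt0.
elim: b => [|b IH] n; first by rewrite addn0 expr0 mul1r.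
rewrite addnS exprS -mulrA; apply: le_trans (Fk _) _.
by rewrite ler_pM2l.
Qed.

(** Index translations cost a constant factor by shift invariance, and l is absorbed because f and F
    are bounded below by their positive first terms. *)
Lemma same_growth_translate f F a b (l : R) : same_growth F (Defs.shift F) ->
  (forall k, f (a + k)%N = F (b + k)%N - l) -> same_growth f F.
Proof.
move=> FS fF.
have [ca ca0 Fa] := same_growth_addn a FS; have [cb cb0 Fb] := same_growth_addn b FS.
have F0 := growth_gt0 F 0; have f0 := growth_gt0 f 0.
have lF n : `|l| <= `|l| / F 0%N * F n.
  by rewrite -mulrA ler_peMr// ler_pdivlMl// mulr1 growth_nd.
have lf n : `|l| <= `|l| / f 0%N * f n.
  by rewrite -mulrA ler_peMr// ler_pdivlMl// mulr1 growth_nd.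
apply: (@same_growth_le2 _ _ (cb + `|l| / F 0%N)
  (ca * (1 + `|l| / f 0%N + F 0%N / f 0%N))).
- by rewrite ltr_pwDl// divr_ge0// ltW.
- rewrite mulr_gt0// ltr_wpDr//; first by rewrite divr_ge0// ltW.
  by rewrite ltr_pwDl// divr_ge0// ltW.
- move=> n; apply: le_trans (_ : f (a + n)%N <= _).
    by rewrite growth_nd// leq_addl.
  rewrite fF mulrDl; apply: lerD; first by rewrite addnC.
  by apply: le_trans (lF n); rewrite -normrN ler_norm.
- move=> n; rewrite -mulrA; apply: le_trans (_ : F (n - a + a)%N <= _).
    by rewrite growth_nd// addnC -leq_subLR.
  apply: le_trans (Fa _) _; rewrite ler_pM2l// !mulrDl mul1r.
  (* For n <= a the truncated difference n - a is 0, and the summand F 0 / f 0 of the constant takes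
     care of F 0. *)
  have [na|an] := leqP n a.
    rewrite (eqP (na : (n - a == 0)%N)) ler_wpDl//.
      by rewrite addr_ge0 ?growth_ge0// (le_trans _ (lf n)).
    by rewrite -mulrA ler_peMr ?(ltW F0)// ler_pdivlMl// mulr1 growth_nd.
  apply: ler_wpDr; first by rewrite mulr_ge0 ?growth_ge0// divr_ge0 ?growth_ge0.
  apply: le_trans (_ : F (b + (n - a))%N <= _); first by rewrite growth_nd// leq_addl.
  rewrite -[leLHS](subrK l) -fF subnKC ?(ltnW an)// lerD2l.
  by apply: le_trans (lf n); exact: ler_norm.
Qed.

(** Subtracting l moves only finitely many entries across 0: the first k0 values of F are lost when
    l >= 0, or j0 values of - G are gained when l < 0. Up to the constant l, the new list is
    eventually an index translate of F. *)
Lemma lists_positive_shift (a : nat -> R) F G (p q : nat -> nat) (l : R) :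
  injective p -> injective q ->
  (forall k, a (p k) = F k) -> (forall k, a (q k) = - G k) ->
  (forall n, (exists k, p k = n) \/ (exists k, q k = n)) ->
  (forall n, a n != l) -> same_growth F (Defs.shift F) ->
  exists2 f : growth_fun R, lists_positive (fun n => a n - l) f &
    same_growth f F.
Proof.
move=> pinj qinj ap aq pq al FS.
case: (ex_minnP (growth_unbounded F l)) => k0 k0l k0min.
have exG : exists j, - l <= G j.
  by have [j lj] := growth_unbounded G (- l); exists j; exact: ltW.
case: (ex_minnP exG) => j0 j0l j0min.
have Fk0 k : l < F (k0 + k)%N.
  by apply: lt_le_trans k0l _; rewrite growth_nd// leq_addr.
have Gj j : (j < j0)%N -> l < - G j.
  move=> jj; rewrite ltNge; apply/negP => Gl.
  have /j0min : - l <= G j by lra.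
  by rewrite leqNgt jj.
(* The gained entries come first and in reverse, since - G is nonincreasing. One formula serves both
   signs of l, as k0 or j0 is then 0. *)
pose e k := if (k < j0)%N then q (j0 - k.+1)%N else p (k0 + (k - j0))%N.
pose f k := a (e k) - l.
have f0 k : 0 < f k.
  rewrite /f /e subr_gt0; case: ltnP => kj; last by rewrite ap.
  by rewrite aq Gj// -subn_gt0 subKn.
have fnd : nondecreasing_seq f.
  move=> i j ij; rewrite /f /e lerD2r.
  case: (ltnP i j0) => ij0; case: (ltnP j j0) => jj0.
  - by rewrite !aq lerN2 growth_nd// leq_sub2l.
  - by rewrite aq ap (le_trans _ (growth_ge0 _ _))// oppr_le0 growth_ge0.
  - by move: (leq_ltn_trans ij jj0); rewrite ltnNge ij0.
  - by rewrite !ap growth_nd// leq_add2l leq_sub2r.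
have fF k : f (j0 + k)%N = F (k0 + k)%N - l.
  by rewrite /f /e ltnNge leq_addr/= addKn ap.
have fub M : exists n, M < f n.
  have [n Mn] := growth_unbounded F (M + l); exists (j0 + n)%N.
  rewrite fF ltrBrDr; apply: lt_le_trans Mn _.
  by rewrite growth_nd// leq_addl.
exists (GrowthFun f0 fnd fub); last first.
  exact: (@same_growth_translate (GrowthFun f0 fnd fub) F j0 k0 l FS fF).
exists e; split => //=.
- move=> i j; rewrite /e; case: (ltnP i j0) => ij0; case: (ltnP j j0) => jj0.
  + by move=> /qinj; lia.
  + move=> E; exfalso; have := growth_gt0 F (k0 + (j - j0))%N.
    by rewrite -ap -E aq oppr_gt0 ltNge growth_ge0.
  + move=> E; exfalso; have := growth_gt0 F (k0 + (i - j0))%N.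
    by rewrite -ap E aq oppr_gt0 ltNge growth_ge0.
  + by move=> /pinj; lia.
- move=> n; rewrite subr_gt0; have [[k <-]|[k <-]] := pq n.
    rewrite ap => lF; exists (j0 + (k - k0))%N.
    by rewrite /e ltnNge leq_addr/= addKn subnKC ?k0min.
  rewrite aq => lG; have kj : (k < j0)%N.
    rewrite ltnNge; apply/negP => j0k; have : G j0 <= G k by rewrite growth_nd.
    lra.
  exists (j0 - k.+1)%N; rewrite /e.
  have -> : (j0 - k.+1 < j0)%N by lia.
  by congr q; lia.
Qed.

End ShiftedListing.

(** * Sparse subsequences *)

(** Used for the complement of the sparse indices: gaps of at most 2 transfer the shift invariance
    of h to the subsequence. *)
Lemma enumerate_gap2 (S : pred nat) : (forall n, S n || S n.+1) ->
  exists q : nat -> nat, [/\ forall k, S (q k),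
    forall k, (q k < q k.+1)%N, forall k, (q k.+1 <= (q k).+2)%N &
    forall n, S n -> exists k, q k = n].
Proof.
move=> S2; pose nxt n := if S n.+1 then n.+1 else n.+2.
pose q := fix q k := if k is k'.+1 then nxt (q k') else if S 0%N then 0%N else 1%N.
have qS k : S (q k).
  case: k => [|k] /=; [have := S2 0%N|have := S2 (q k).+1; rewrite /nxt].
    by case: ifP.
  by case: ifP => // ->.
have qlt k : (q k < q k.+1)%N by rewrite /= /nxt; case: ifP.
have ltq k : (k <= q k)%N.
  by elim: k => // k IH; apply: leq_ltn_trans IH (qlt k).
exists q; split => //.
  by move=> k; rewrite /= /nxt; case: ifP.
move=> n Sn; have exk : exists k, (n <= q k)%N by exists n.
case: (ex_minnP exk) => [[|k]] nk kmin.
  exists 0%N; apply/eqP; rewrite eqn_leq nk andbT /=.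
  by case: ifP => // S0; case: n Sn {nk kmin exk} => // Sn; rewrite Sn in S0.
have qkn : (q k < n)%N.
  by rewrite ltnNge; apply/negP => /kmin; rewrite ltnn.
exists k.+1; apply/eqP; rewrite eqn_leq nk andbT /= /nxt.
case: ifP => // Sk; case: ltngtP qkn => // qkn _.
by rewrite ltn_neqAle qkn andbT; apply/eqP => E; rewrite E Sn in Sk.
Qed.

Lemma increasing_lt (e : nat -> nat) : (forall k, (e k < e k.+1)%N) ->
  forall i j, (i < j)%N -> (e i < e j)%N.
Proof.
move=> elt i; elim=> // j IH; rewrite ltnS leq_eqVlt => /predU1P[->//|/IH ij].
exact: ltn_trans ij (elt j).
Qed.

Lemma increasing_inj (e : nat -> nat) : (forall k, (e k < e k.+1)%N) -> injective e.
Proof.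
move=> elt i j eij; case: (ltngtP i j) => // /(increasing_lt elt);
by rewrite eij ltnn.
Qed.

Section SparseGrowth.
Variables (R : realType) (h : growth_fun R).

Lemma sqrt_subsequence (e : nat -> nat) : (forall k, (e k < e k.+1)%N) ->
  exists F : growth_fun R, forall k, F k = Num.sqrt (h (e k)).
Proof.
move=> elt; pose f k := Num.sqrt (h (e k)).
have lte k : (k <= e k)%N by elim: k => // k IH; apply: leq_ltn_trans IH (elt k).
have f0 k : 0 < f k by rewrite sqrtr_gt0 growth_gt0.
have fnd : nondecreasing_seq f.
  move=> i j; rewrite leq_eqVlt => /predU1P[->//|ij].
  by rewrite ler_wsqrtr// growth_nd// ltnW// increasing_lt.
have fub M : exists n, M < f n.
  have [n nM] := growth_unbounded h (M ^+ 2); exists n.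
  apply: le_lt_trans (ler_norm M) _; rewrite -sqrtr_sqr ltr_sqrt ?growth_gt0//.
  by apply: lt_le_trans nM _; rewrite growth_nd.
by exists (GrowthFun f0 fnd fub).
Qed.

Variables (K D : R).
Hypothesis hK : forall n, h n.+1 <= K * h n.
Hypothesis KD : K ^+ 2 < D.

Let K1 : 1 <= K.
Proof.
have h0 := growth_gt0 h 0; rewrite -(ler_pM2r h0) mul1r.
by apply: le_trans (hK 0); rewrite growth_nd.
Qed.

Let D1 : 1 < D.
Proof. by apply: le_lt_trans KD; rewrite expr_ge1// (le_trans ler01). Qed.

(** p k is the first index where h reaches h(0) D^k. One step multiplies h by at most K, so the
    overshoot is at most K, and h(p k + 1) <= K^2 h(0) D^k < h(0) D^(k+1) keeps p k and p (k+1) from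
    being adjacent. *)
Lemma geometric_subsequence : exists p : nat -> nat,
  (forall k, h 0%N * D ^+ k <= h (p k) <= K * (h 0%N * D ^+ k)) /\
  (forall k, ((p k).+1 < p k.+1)%N).
Proof.
have K0 : 0 < K by rewrite (lt_le_trans ltr01).
have D0 : 0 < D by rewrite (lt_trans ltr01).
have h0 := growth_gt0 h 0.
have /choice[p pP] : forall k, exists n, h 0%N * D ^+ k <= h n /\
    forall m, h 0%N * D ^+ k <= h m -> (n <= m)%N.
  move=> k; have exn : exists n, h 0%N * D ^+ k <= h n.
    by have [n nM] := growth_unbounded h (h 0%N * D ^+ k); exists n; exact: ltW.
  by case: (ex_minnP exn) => n nh nmin; exists n.
have up k : h (p k) <= K * (h 0%N * D ^+ k).
  have [] := pP k; case: (p k) => [|n] _ nmin.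
    by rewrite mulrCA ler_peMr ?(ltW h0)// -[1]mulr1 ler_pM// exprn_ege1// ltW.
  apply: le_trans (hK n) _; rewrite ler_pM2l// leNgt; apply/negP => /ltW/nmin.
  by rewrite ltnn.
exists p; split=> k; first by rewrite up andbT; have [] := pP k.
have [pk _] := pP k.+1; rewrite ltnNge; apply/negP => pp.
have : h 0%N * D ^+ k.+1 <= h (p k).+1 by apply: le_trans pk _; rewrite growth_nd.
apply/negP; rewrite -ltNge; apply: le_lt_trans (hK _) _.
apply: le_lt_trans (_ : K * (K * (h 0%N * D ^+ k)) < _).
  by rewrite ler_pM2l.
by rewrite mulrA -expr2 (exprS D) (mulrCA (h _) D) ltr_pM2r ?mulr_gt0 ?exprn_gt0.
Qed.

Lemma sparse_signs : exists (p q : nat -> nat) (F G : growth_fun R),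
  [/\ (forall k, F k = Num.sqrt (h (p k))) /\ (forall k, G k = Num.sqrt (h (q k))),
      injective p /\ injective q,
      forall i j, p i <> q j,
      forall n, (exists k, p k = n) \/ (exists k, q k = n) &
      [/\ same_growth F (Defs.shift F), same_growth G (Defs.shift G) &
       forall k, h 0%N * D ^+ k <= F k ^+ 2 <= K * (h 0%N * D ^+ k)]].
Proof.
have K0 : 0 < K by rewrite (lt_le_trans ltr01).
have D0 : 0 < D by rewrite (lt_trans ltr01).
have h0 := growth_gt0 h 0.
have [p [pb p2]] := geometric_subsequence.
have plt k : (p k < p k.+1)%N by rewrite ltnW.
have p2' i j : (i < j)%N -> ((p i).+1 < p j)%N.
  move=> ij; apply: leq_trans (p2 i) _.
  by move: ij; rewrite leq_eqVlt => /predU1P[<-//|/(increasing_lt plt)/ltnW].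
pose S : pred nat := fun n => ~~ `[< exists k, p k = n >].
have S2 n : S n || S n.+1.
  rewrite /S -negb_and; apply/negP => /andP[/asboolP[i pi] /asboolP[j pj]].
  case: (ltngtP i j) => ij.
  - by have := p2' _ _ ij; rewrite pi pj ltnn.
  - by have := p2' _ _ ij; rewrite pi pj; lia.
  - by move: pj; rewrite -ij pi => /n_Sn.
have [q [qS qlt q2 qsurj]] := enumerate_gap2 S2.
have [F FE] := sqrt_subsequence plt; have [G GE] := sqrt_subsequence qlt.
exists p, q, F, G; split => //.
- by split; exact: increasing_inj.
- by move=> i j pq; have /asboolPn := qS j; apply; exists i.
- move=> n; have [nP|nP] := pselect (exists k, p k = n); [by left|right].
  by apply: qsurj; exact/asboolPn.
have FF k : h 0%N * D ^+ k <= F k ^+ 2 <= K * (h 0%N * D ^+ k).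
  by rewrite FE sqr_sqrtr ?growth_ge0.
split => //.
  (* The squares grow by a factor of at most K D, which is at least 1 and hence bounds its own
     square root. *)
  apply/same_growth_shiftP; exists (K * D) => [|k]; first exact: mulr_gt0.
  rewrite -(@ler_pXn2r _ 2) ?nnegrE ?mulr_ge0 ?growth_ge0 ?(ltW K0) ?(ltW D0)//.
  have /andP[_ Fk] := FF k.+1; have /andP[Fk' _] := FF k.
  apply: le_trans Fk _; rewrite [leRHS]exprMn.
  apply: le_trans (_ : (K * D) * F k ^+ 2 <= _).
    by rewrite (exprS D) (mulrCA (h _) D) [leLHS]mulrA ler_pM2l ?mulr_gt0.
  rewrite ler_wpM2r ?sqr_ge0// expr2 ler_peMr ?mulr_ge0 ?(ltW K0) ?(ltW D0)//.
  by rewrite -[1]mulr1 ler_pM// ltW.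
apply/same_growth_shiftP; exists K => [//|k].
rewrite !GE -(@ler_pXn2r _ 2) ?nnegrE ?mulr_ge0 ?sqrtr_ge0 ?(ltW K0)//.
rewrite exprMn !sqr_sqrtr ?growth_ge0//.
apply: le_trans (_ : h (q k).+2 <= _); first by rewrite growth_nd.
by apply: le_trans (hK _) _; rewrite expr2 -mulrA ler_pM2l.
Qed.

End SparseGrowth.

(** Equivalence would bound the powers of D2 / D1 > 1, against Bernoulli's inequality and the
    Archimedean property. *)
Lemma geometric_types_differ (R : realType) (F1 F2 : growth_fun R) (M K D1 D2 : R) :
  0 < M -> 0 < K -> 0 < D1 -> D1 < D2 ->
  (forall k, F1 k ^+ 2 <= K * (M * D1 ^+ k)) -> (forall k, M * D2 ^+ k <= F2 k ^+ 2) ->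
  ~ same_growth F1 F2.
Proof.
move=> M0 K0 D10 D12 F1D F2D /same_growth_le[c c0 cP].
pose t := D2 / D1 - 1.
have t0 : 0 < t by rewrite subr_gt0 ltr_pdivlMr// mul1r.
have bound k : (D2 / D1) ^+ k <= c ^+ 2 * K.
  rewrite expr_div_n ler_pdivrMr ?exprn_gt0// -(ler_pM2l M0).
  apply: le_trans (F2D k) _; apply: le_trans (_ : (c * F1 k) ^+ 2 <= _).
    rewrite ler_pXn2r ?nnegrE ?mulr_ge0 ?growth_ge0 ?(ltW c0)//.
    by have [] := cP k.
  have := F1D k; rewrite exprMn => FK.
  have -> : M * (c ^+ 2 * K * D1 ^+ k) = c ^+ 2 * (K * (M * D1 ^+ k)) by ring.
  by rewrite ler_pM2l// exprn_gt0.
have bern k : 1 + k%:R * t <= (D2 / D1) ^+ k.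
  have -> : D2 / D1 = 1 + t by rewrite /t; ring.
  elim: k => [|k IH]; first by rewrite mul0r addr0 expr0.
  rewrite exprS; apply: le_trans (_ : (1 + t) * (1 + k%:R * t) <= _).
    have k0 : 0 <= k%:R * t * t by rewrite !mulr_ge0 ?(ltW t0).
    rewrite -natr1; lra.
  by rewrite ler_pM2l// addr_gt0.
have B0 : 0 <= c ^+ 2 * K / t.
  by rewrite !mulr_ge0 ?invr_ge0 ?(ltW K0) ?(ltW t0) ?(ltW c0).
have := archi_boundP B0; set n := Num.bound _ => nB.
have := le_trans (bern n) (bound n).
rewrite ltr_pdivrMr// in nB; lra.
Qed.

(** * Diagonal Floer type operators and infinitely many pairs of types *)

Section DiagonalFloer.
Variables (R : realType) (h : growth_fun R) (d : nat -> R).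
Local Notation H r := (l2 h r).
Local Notation "<| x , y |>_ r" := (@l2_inner R h r x y)
  (at level 0, x, y at level 99, r at level 0).
Local Notation inc := (@incl10 R h).

Hypothesis dh : forall n, d n ^+ 2 = h n.

Lemma diag_weight10 n : h n `^ 0 * d n ^+ 2 = h n `^ 1.
Proof. by rewrite powRr0 mul1r dh powRr1// growth_ge0. Qed.

Lemma diag_weight21 n : h n `^ 1 * d n ^+ 2 = h n `^ 2.
Proof. by rewrite powRr1 ?growth_ge0// dh -expr2 powR_mulrn// growth_ge0. Qed.

Lemma diag_neq0 n : d n != 0.
Proof. by rewrite -sqrf_eq0 dh gt_eqF// growth_gt0. Qed.

Local Notation A := (diag_op diag_weight10).

Lemma diag_weak_hessian : weak_hessian h A.
Proof.
split.
- exact: (isomorphism_fredholm (diag_isomorphism _ diag_neq0)).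
- move=> x y; congr (limn (series _)); apply/funext => n.
  rewrite /weighted_prod -[A x n]/(d n * x n) -[A y n]/(d n * y n).
  rewrite -[inc x n]/(x n) -[inc y n]/(y n); ring.
- exists (diag_op diag_weight21); split.
    by move=> x; exact: val_inj.
  exact: (isomorphism_fredholm (diag_isomorphism _ diag_neq0)).
Qed.

Lemma diag_eigenspace l mu : Defs.eigenspace (shift_op A l) mu =
  [set x : H 1 | forall n, d n - l <> mu -> x n = 0].
Proof.
have coordE (x : H 1) n : shift_op A l x n = (d n - l) * x n.
  by rewrite -[LHS]/(d n * x n - l * x n) mulrBl.
apply/seteqP; split => x /=.
  move=> Ax n dl.
  have : (d n - l) * x n = mu * x n.
    exact: etrans (esym (coordE x n)) (congr1 (fun y : H 0 => y n) Ax).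
  by move=> /eqP; rewrite -subr_eq0 -mulrBl mulf_eq0 subr_eq0 => /orP[/eqP|/eqP].
move=> xE; apply/val_inj/funext => n.
apply: etrans (coordE x n) _; rewrite -[RHS]/(mu * x n).
by have [->//|/eqP/xE ->] := eqVneq (d n - l) mu; rewrite !mulr0.
Qed.

Lemma dirac_neq0 n : dirac_l2 h 1 n != 0.
Proof.
apply/eqP => /(congr1 (fun x : H 1 => x n)) /=.
by rewrite /dirac_seq eqxx; exact/eqP/oner_neq0.
Qed.

Lemma diag_eigenvalue n : is_eigenvalue A (d n).
Proof.
exists (dirac_l2 h 1 n); last exact: dirac_neq0.
apply/val_inj/funext => i.
rewrite -[LHS]/(d i * (i == n)%:R) -[RHS]/(d n * (i == n)%:R).
by case: eqP => [->//|_]; rewrite !mulr0.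
Qed.

Lemma diag_not_spec l n : ~ spec A l -> d n != l.
Proof.
move=> /contrapT[_ [S [_ /cancel_linear_ker0 AS _]]]; apply/eqP => dl.
have /eqP := dirac_neq0 n; apply; apply: AS; apply/val_inj/funext => i.
rewrite -[LHS]/(d i * (i == n)%:R - l * (i == n)%:R) -[RHS]/(0 : R).
by case: eqP => [->|_]; rewrite ?dl ?subrr// !mulr0 subrr.
Qed.

(** The eigenvalues of A - l are the d n - l, so both lists come from [lists_positive_shift]. Shift
    invariance of F and G makes their types independent of l. *)
Lemma diag_floer (p q : nat -> nat) (F G : growth_fun R) :
  injective p -> injective q ->
  (forall n, (exists k, p k = n) \/ (exists k, q k = n)) ->
  (forall k, d (p k) = F k) -> (forall k, d (q k) = - G k) ->
  same_growth F (Defs.shift F) -> same_growth G (Defs.shift G) ->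
  floer_of_type h (type_of_growth G) (type_of_growth F) A.
Proof.
move=> pinj qinj pq dp dq FS GS; split.
  split; first exact: diag_weak_hessian.
    move=> /finite_set_bounded[M MP]; have [k kM] := growth_unbounded F M.
    have : F k <= M.
      by apply: MP; split; [exact: growth_gt0|rewrite -dp; exact: diag_eigenvalue].
    by rewrite leNgt kM.
  move=> /(finite_image -%R)/finite_set_bounded[M MP].
  have [k kM] := growth_unbounded G M.
  have : G k <= M.
    apply: MP; exists (- G k); last exact: opprK.
    by split; [rewrite oppr_lt0 growth_gt0|rewrite -dq; exact: diag_eigenvalue].
  by rewrite leNgt kM.
move=> l lA; have dl n := diag_not_spec n lA; split.
  have [|||||f fl fG] :=
    (* The negative list of d - l is the positive list of - d - (- l), with the two families
       exchanged. *)
    @lists_positive_shift R (fun n => - d n) G F q p (- l) qinj pinj.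
  - by move=> k; rewrite dq opprK.
  - by move=> k; rewrite dp.
  - by move=> n; have [|] := pq n; [right|left].
  - by move=> n; rewrite eqr_opp.
  - exact: GS.
  exists f; last exact/type_of_growthP.
  apply: (lists_positive_with_mult _ fl) => mu _.
  rewrite diag_eigenspace.
  by apply/seteqP; split => x xE n dn; apply: xE => E; apply: dn; lra.
have [||f fl fF] := @lists_positive_shift R d F G p q l pinj qinj dp dq pq.
- exact: dl.
- exact: FS.
exists f; last exact/type_of_growthP.
by apply: (lists_positive_with_mult _ fl) => mu _; exact: diag_eigenspace.
Qed.

End DiagonalFloer.

Lemma floer_of_type_infinite (R : realType) (h : growth_fun R) :
  same_growth h (Defs.shift h) ->
  infinite_set [set ab : growth_type R * growth_type R |
       [/\ shift_invariant ab.1, shift_invariant ab.2 &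
           floer_of_type h ab.1 ab.2 !=set0]].
Proof.
move=> /same_growth_shiftP[K K0 hK].
(* Pairwise distinct ratios above K^2; the types of the corresponding F i are distinct, so the
   second components alone form an infinite set. *)
pose D i := K ^+ 2 + 1 + i%:R.
have KD i : K ^+ 2 < D i by rewrite /D -addrA ltrDl ltr_wpDr.
have D0 i : 0 < D i by apply: le_lt_trans (KD i); exact: sqr_ge0.
have /choice[F FP] : forall i, exists F : growth_fun R,
    (exists a, [/\ shift_invariant a, shift_invariant (type_of_growth F) &
       floer_of_type h a (type_of_growth F) !=set0]) /\
    forall k, h 0%N * D i ^+ k <= F k ^+ 2 <= K * (h 0%N * D i ^+ k).
  move=> i; have [p [q [F [G [[FE GE] [pinj qinj] pq_disj pq [FS GS FD]]]]]] :=
    sparse_signs hK (KD i).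
  exists F; split => //; exists (type_of_growth G).
  split; [exact/shift_invariantE|exact/shift_invariantE|].
  pose d n := if `[< exists k, p k = n >] then Num.sqrt (h n) else - Num.sqrt (h n).
  have dh n : d n ^+ 2 = h n.
    by rewrite /d; case: ifP; rewrite ?sqrrN sqr_sqrtr// growth_ge0.
  exists (diag_op (diag_weight10 dh)); apply: (diag_floer dh pinj qinj pq) => // k.
    by rewrite /d asboolT ?FE//; exists k.
  by rewrite /d asboolF ?GE// => -[j] /pq_disj.
set X := [set ab | _] => Xfin.
have Yfin := finite_image snd Xfin.
apply: infinite_nat.
apply: (@sub_finite_set _ _
  ((fun i => type_of_growth (F i)) @^-1` [set ab.2 | ab in X])).
  move=> i _ /=; have [[a [aS FS aF]] _] := FP i.
  by exists (a, type_of_growth (F i)).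
apply: finite_preimage Yfin => i j _ _ /type_of_growthP Fij.
have [_ Fi] := FP i; have [_ Fj] := FP j.
have h0 := growth_gt0 h 0.
case: (ltngtP i j) => // ij; exfalso.
  apply: (@geometric_types_differ _ (F i) (F j) (h 0%N) K (D i) (D j)) => //.
  - by rewrite /D ltrD2l ltr_nat.
  - by move=> k; have /andP[] := Fi k.
  - by move=> k; have /andP[] := Fj k.
apply: (@geometric_types_differ _ (F j) (F i) (h 0%N) K (D j) (D i)) => //.
- by rewrite /D ltrD2l ltr_nat.
- by move=> k; have /andP[] := Fj k.
- by move=> k; have /andP[] := Fi k.
- exact: same_growth_sym.
Qed.

Theorem theoremC (R : realType) (h : growth_fun R) :
  (forall a b : growth_type R, shift_invariant a -> shift_invariant b ->
     floer_of_type h a b !=set0 -> shift_invariant (type_of_growth h)) /\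
  (shift_invariant (type_of_growth h) ->
     (forall a : growth_type R,
        floer_inv_of_type h a a !=set0 -> shift_invariant a) /\
     infinite_set [set ab : growth_type R * growth_type R |
       [/\ shift_invariant ab.1, shift_invariant ab.2 &
           floer_of_type h ab.1 ab.2 !=set0]]).
Proof.
split=> [a b aS bS [A [[[A_fred A_sym _] _ _] Atype]]|/shift_invariantE hS].
  (* The growth types of [A] are only prescribed at regular values, so one must exist. *)
  have [l lA] := fredholm_not_spec A_sym A_fred.
  have [[f Af fa] [g Ag gb]] := Atype l lA.
  move: lA => /contrapT Aiso.
  have [[c c0 up] [C C0 low]] := weyl_bounds (shift_op_symmetric l A_sym) Aiso Af Ag.
  apply/shift_invariantE; apply: (weyl_weight_shift c0 C0 up low).
    by apply/shift_invariantE; rewrite fa.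
  by apply/shift_invariantE; rewrite gb.
split; last exact: floer_of_type_infinite.
move=> a [A [[[[_ A_sym _] _ _] Aiso] [[f Af <-] [g Ag /type_of_growthP gf]]]].
have [[c c0 up] [C C0 low]] := weyl_bounds A_sym Aiso Af Ag.
apply/shift_invariantE; apply: (weyl_eigen_shift c0 C0 up low) hS.
exact: same_growth_sym.
Qed.
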